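(* Let $\mathbf{r}=(r,r')$ be a pair of cardinals $\ge 1$, $F$ be an infinite division ring, $K$ be a field, and $V$ be a left $F$-vector space of dimension $r+r'$. Then any nonzero $K$-subrepresentation of $\mathrm{GL}_F(V)$ in $K[\mathrm{Gr}(\mathbf{r},V)]$ contains $K\otimes M_1$. In particular, $K\otimes M_1$ is the only irreducible $K$-subrepresentation of $\mathrm{GL}_F(V)$ in $K[\mathrm{Gr}(\mathbf{r},V)]$. Moreover, the following conditions are equivalent: (i) at least one of $r$ and $r'$ is finite; (ii) $M_1=\mathbb Z[\mathrm{Gr}(\mathbf{r},V)]^{\circ}$; (iii) $K\otimes M_1=K[\mathrm{Gr}(\mathbf{r},V)]^{\circ}$; (iv) $K[\mathrm{Gr}(\mathbf{r},V)]^{\circ}$ is irreducible; (v) $K[\mathrm{Gr}(\mathbf{r},V)]/(K\otimes M_1)$ is irreducible; (vi) $K[\mathrm{Gr}(\mathbf{r},V)]/(K\otimes M_1)\cong K$.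
   Context: For a pair of cardinals $\mathbf{r}=(r,r')$ with $r+r'=\dim_F V$, $\mathrm{Gr}(\mathbf{r},V)$ denotes the set of all $F$-vector subspaces of $V$ of dimension $r$ and codimension $r'$. For a ring $A$, $A[\mathrm{Gr}(\mathbf{r},V)]=A\otimes\mathbb Z[\mathrm{Gr}(\mathbf{r},V)]$ is the module of all finite formal linear combinations $\sum_j a_j[L_j]$ with $a_j\in A$, $L_j\in\mathrm{Gr}(\mathbf{r},V)$, and $A[\mathrm{Gr}(\mathbf{r},V)]^{\circ}$ is its submodule of combinations with $\sum_j a_j=0$. The group $G=\mathrm{GL}_F(V)=\mathrm{Aut}_F(V)$ acts on these modules through its natural action on $\mathrm{Gr}(\mathbf{r},V)$. $M_1\subseteq\mathbb Z[\mathrm{Gr}(\mathbf{r},V)]^{\circ}$ is the $G$-submodule generated by the difference $[L]-[L']$ for any $L,L'\in\mathrm{Gr}(\mathbf{r},V)$ with $\dim L/(L\cap L')=\dim L'/(L\cap L')=1$ ($G$ acts transitively on such pairs, so $M_1$ does not depend on the choice). $K\otimes M_1$ (tensor product over $\mathbb Z$) is regarded as a submodule of $K[\mathrm{Gr}(\mathbf{r},V)]$. In (vi), $K$ denotes the trivial one-dimensional representation. *)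

(* Defs.v *)
From HB Require Import structures.
From mathcomp Require Import all_boot all_algebra.
From mathcomp Require Import generic_quotient ring_quotient.
From mathcomp Require Import boolp classical_sets functions cardinality.
From mathcomp Require Import freeg.

Set Implicit Arguments.
Unset Strict Implicit.
Unset Printing Implicit Defensive.

Import GRing.Theory.
Local Open Scope classical_set_scope.
Local Open Scope card_scope.
Local Open Scope quotient_scope.
Local Open Scope ring_scope.

Section Submodules.
Variables (R : nzRingType) (V : lmodType R).

Definition is_submodule (S : set V) : Prop := GRing.submod_closed (mem S).

Lemma is_submoduleP (S : set V) :
  is_submodule S <-> S 0 /\ (forall a u v, S u -> S v -> S (a *: u + v)).
Proof.
split=> [[/set_mem S0 Slin]|[S0 Slin]]; split=> //.
- by move=> a u v /mem_set Su /mem_set Sv; apply/set_mem/Slin.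
- exact/mem_set.
- by move=> a u v /set_mem Su /set_mem Sv; apply/mem_set/Slin.
Qed.

Record submodule := Submodule {
  submodule_set :> set V;
  submodule_closed : is_submodule submodule_set }.

Lemma submodule_inj (W1 W2 : submodule) : W1 = W2 :> set V -> W1 = W2.
Proof.
case: W1 W2 => [S1 P1] [S2 P2] /= eS; case: _ / eS P2 => P2.
by congr Submodule; exact: Prop_irrelevance.
Qed.

Lemma smallest_is_submodule (S : set V) : is_submodule (smallest is_submodule S).
Proof.
apply/is_submoduleP; split=> [M [/is_submoduleP[M0 _] _] //|a u v Su Sv M].
by move=> [Msub SM]; have /is_submoduleP[_] := Msub; apply;
  [apply: Su|apply: Sv].
Qed.

Definition span (S : set V) : submodule := Submodule (smallest_is_submodule S).

Lemma setI_is_submodule (W1 W2 : submodule) : is_submodule (W1 `&` W2).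
Proof.
case: W1 W2 => [S1 /is_submoduleP[S10 S1l]] [S2 /is_submoduleP[S20 S2l]] /=.
apply/is_submoduleP; split=> // a u v [? ?] [? ?].
by split; [apply: S1l|apply: S2l].
Qed.

Definition submoduleI (W1 W2 : submodule) : submodule :=
  Submodule (setI_is_submodule W1 W2).

Definition lin_indep (B : set V) : Prop :=
  forall (s : seq V) (c : V -> R), uniq s -> [set` s] `<=` B ->
    \sum_(v <- s) c v *: v = 0 -> forall v, v \in s -> c v = 0.

(* Cardinals, possibly infinite, are represented by arbitrary types: I stands *)
(* for the number of elements of I.                                           *)
Definition has_dim (U : set V) (I : Type) : Prop :=
  exists B : set V, [/\ lin_indep B, span B = U :> set V & B #= [set: I]].

End Submodules.

Section QuotientModule.
Variables (R : nzRingType) (V : lmodType R) (W : submodule V).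

Definition in_submodule : {pred V} := mem (submodule_set W).

HB.instance Definition _ :=
  GRing.isSubmodClosed.Build R V in_submodule
    (GRing.submod_closed_semi (submodule_closed W)).

Definition quotmod : Type := Quotient.quot in_submodule.

HB.instance Definition _ := Choice.on quotmod.
HB.instance Definition _ := EqQuotient.on quotmod.
HB.instance Definition _ := GRing.Zmodule.on quotmod.
HB.instance Definition _ := ZmodQuotient.on quotmod.

Definition quotmod_scale (a : R) (x : quotmod) : quotmod :=
  \pi_quotmod (a *: repr x).

Lemma eq_quotmod (x y : V) : \pi_quotmod x = \pi_quotmod y <-> submodule_set W (x - y).
Proof.
rewrite -[submodule_set _ _]in_setE; split=> [e|e].
  by have := Quotient.idealrBE in_submodule x y => ->; apply/eqP.
by apply/eqP; have := Quotient.idealrBE in_submodule x y => <-.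
Qed.

Lemma pi_quotmod_scale a x :
  quotmod_scale a (\pi_quotmod x) = \pi_quotmod (a *: x).
Proof.
apply/eq_quotmod; rewrite -scalerBr.
have /eq_quotmod : \pi_quotmod (repr (\pi_quotmod x)) = \pi_quotmod x.
  by rewrite reprK.
have /is_submoduleP[W0 Wlin] := submodule_closed W.
by move=> Wx; rewrite -[_ *: _]addr0; apply: Wlin.
Qed.

Fact quotmod_scaleA a b x :
  quotmod_scale a (quotmod_scale b x) = quotmod_scale (a * b) x.
Proof.
by rewrite -[x]reprK (pi_quotmod_scale b) !pi_quotmod_scale scalerA.
Qed.

Fact quotmod_scale1 : left_id 1 quotmod_scale.
Proof. by move=> x; rewrite -[x]reprK !pi_quotmod_scale scale1r. Qed.

Fact quotmod_scaleDr : right_distributive quotmod_scale +%R.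
Proof.
move=> a x y; rewrite -[x]reprK -[y]reprK -(raddfD \pi_quotmod).
by rewrite !pi_quotmod_scale scalerDr (raddfD \pi_quotmod).
Qed.

Fact quotmod_scaleDl x : {morph quotmod_scale^~ x : a b / a + b}.
Proof.
by move=> a b; rewrite -[x]reprK !pi_quotmod_scale scalerDl (raddfD \pi_quotmod).
Qed.

HB.instance Definition _ := GRing.Zmodule_isLmodule.Build R quotmod
  quotmod_scaleA quotmod_scale1 quotmod_scaleDr quotmod_scaleDl.

Definition quotproj (x : V) : quotmod := \pi_quotmod x.

Fact quotproj_linear : linear quotproj.
Proof.
move=> a x y; rewrite /quotproj (raddfD \pi_quotmod); congr (_ + _).
exact/esym/pi_quotmod_scale.
Qed.

HB.instance Definition _ :=
  GRing.isLinear.Build R V quotmod *:%R quotproj quotproj_linear.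

Lemma quotprojK (x : quotmod) : quotproj (repr x) = x.
Proof. exact: reprK. Qed.

End QuotientModule.

Section DimTransport.
Variables (R : nzRingType) (U V : lmodType R) (f : {linear U -> V}).

Lemma image_is_submodule (S : set U) :
  is_submodule S -> is_submodule (f @` S).
Proof.
move=> /is_submoduleP[S0 Slin]; apply/is_submoduleP; split.
  by exists 0; rewrite ?linear0.
move=> a _ _ [u Su <-] [v Sv <-]; exists (a *: u + v); first exact: Slin.
by rewrite linearP.
Qed.

Lemma preimage_is_submodule (S : set V) :
  is_submodule S -> is_submodule (f @^-1` S).
Proof.
move=> /is_submoduleP[S0 Slin]; apply/is_submoduleP; split=> /=.
  by rewrite linear0.
by move=> a u v Su Sv /=; rewrite linearP; apply: Slin.
Qed.

Lemma image_span (B : set U) : f @` span B = span (f @` B).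
Proof.
apply/seteqP; split.
  move=> _ [x Bx <-] M [Msub BM]; apply: (Bx (f @^-1` M)).
  split; first exact: preimage_is_submodule.
  by move=> y By; apply: BM; exists y.
apply: smallest_sub; first exact/image_is_submodule/smallest_is_submodule.
by move=> _ [x Bx <-]; exists x => //; exact: sub_gen_smallest.
Qed.

Lemma has_dim_image (S : set U) (I : Type) :
  injective f -> has_dim S I -> has_dim (f @` S) I.
Proof.
move=> finj [B [Bfree <- BI]]; exists (f @` B); split.
- move=> s c us sB s0.
  have [t es] : exists t, s = map f t.
    elim: s sB {us s0} => [|x s IHs] sB; first by exists [::].
    have [y By xE] := sB x (mem_head _ _).
    have [|t ->] := IHs; first by move=> z zs; apply: sB; rewrite /= inE zs orbT.
    by exists (y :: t); rewrite -xE.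
  move: us sB s0; rewrite {}es map_inj_uniq// big_map => ut tB.
  under eq_bigr do rewrite -linearZ.
  rewrite -linear_sum -[RHS](linear0 f) => /finj t0 _ /mapP[x xt ->].
  apply: (Bfree t (c \o f) ut _ t0 x xt) => y /= yt.
  by have [|z Bz /finj <-//] := tB (f y); exact: map_f.
- by rewrite image_span.
- by apply: card_eq_trans BI; apply: inj_card_eq => x y _ _; exact: finj.
Qed.

End DimTransport.

Record GL (F : nzRingType) (V : lmodType F) := MkGL {
  gl_fun :> {linear V -> V};
  gl_bij : bijective gl_fun }.

Section Grassmannian.
Variables (F : nzRingType) (V : lmodType F) (I I' : Type).

Record Gr := MkGr {
  gr_space :> submodule V;
  gr_dim : has_dim gr_space I;
  gr_codim : has_dim [set: quotmod gr_space] I' }.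

HB.instance Definition _ := gen_eqMixin Gr.
HB.instance Definition _ := gen_choiceMixin Gr.

Lemma Gr_inj (L1 L2 : Gr) : L1 = L2 :> set V -> L1 = L2.
Proof.
case: L1 L2 => [W1 d1 c1] [W2 d2 c2] /= /submodule_inj eW.
case: _ / eW d2 c2 => d2 c2.
by congr MkGr; exact: Prop_irrelevance.
Qed.

Section Action.
Variables (g : GL V) (L : Gr).

Definition gl_image : submodule V :=
  Submodule (image_is_submodule g (submodule_closed L)).

Fact gl_image_dim : has_dim gl_image I.
Proof. exact: has_dim_image (bij_inj (gl_bij g)) (gr_dim L). Qed.

Definition gl_quot (x : quotmod L) : quotmod gl_image := quotproj _ (g (repr x)).

Fact gl_quotE x : gl_quot (quotproj _ x) = quotproj _ (g x).
Proof.
apply/eq_quotmod; rewrite -linearB; exists (repr (quotproj L x) - x) => //.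
by apply/eq_quotmod; rewrite reprK.
Qed.

Fact gl_quot_linear : linear gl_quot.
Proof.
move=> a x y; rewrite -[x]quotprojK -[y]quotprojK -linearP /=.
by rewrite !gl_quotE !linearP.
Qed.

HB.instance Definition _ := GRing.isLinear.Build F (quotmod L)
  (quotmod gl_image) *:%R gl_quot gl_quot_linear.

Fact gl_image_codim : has_dim [set: quotmod gl_image] I'.
Proof.
have -> : [set: quotmod gl_image] = gl_quot @` setT.
  apply/esym/seteqP; split=> // y _.
  have [h gK hK] := gl_bij g.
  by exists (quotproj _ (h (repr y))); rewrite ?gl_quotE ?hK ?quotprojK.
apply: has_dim_image (gr_codim L) => x y.
rewrite -[x]quotprojK -[y]quotprojK /= !gl_quotE => /eq_quotmod.
rewrite -linearB => -[z Lz /(bij_inj (gl_bij g)) zE].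
by apply/eq_quotmod; rewrite -zE.
Qed.

Definition gr_act : Gr := MkGr gl_image_dim gl_image_codim.

End Action.

(* L / (L :&: L') is the image of L in V / (L :&: L'). *)
Definition adjacent (L L' : Gr) : Prop :=
  has_dim (quotproj (submoduleI L L') @` L) unit /\
  has_dim (quotproj (submoduleI L L') @` L') unit.

End Grassmannian.

Section AdjacentPairs.
Variables (F : nzRingType) (V : lmodType F).

Definition combs (S : set V) : set V :=
  [set x | exists s (c : V -> F),
     [/\ uniq s, [set` s] `<=` S & x = \sum_(v <- s) c v *: v]].

Lemma combsE (s t : seq V) (c : V -> F) : uniq s -> uniq t ->
    {subset s <= t} -> (forall v, v \notin s -> c v = 0) ->
  \sum_(v <- s) c v *: v = \sum_(v <- t) c v *: v.
Proof.
move=> us ut st c0; rewrite [RHS](bigID (mem s)) /= [X in _ + X]big1 ?addr0.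
  rewrite -[RHS]big_filter; apply: perm_big; apply: uniq_perm => //.
    exact: filter_uniq.
  by move=> v; rewrite mem_filter /=; case: (boolP (v \in s)) => // /st ->.
by move=> v /c0 ->; rewrite scale0r.
Qed.

Lemma span_combs (S : set V) : span S = combs S :> set V.
Proof.
apply/seteqP; split; last first.
  move=> _ [s [c [_ sS ->]]] M [/is_submoduleP[M0 Mlin] SM].
  elim: s sS => [|v s IHs] sS; first by rewrite big_nil.
  rewrite big_cons; apply: Mlin.
    by apply/SM/sS; rewrite /= inE eqxx.
  by apply: IHs => w ws; apply: sS; rewrite /= inE ws orbT.
apply: smallest_sub; last first.
  move=> x Sx; exists [:: x], (fun=> 1); split=> //.
    by move=> y /=; rewrite inE => /eqP ->.
  by rewrite big_seq1 scale1r.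
apply/is_submoduleP; split.
  by exists [::], (fun=> 0); split=> //; rewrite big_nil.
move=> a _ _ [s [c [us sS ->]]] [t [d [ut tS ->]]].
pose c' v := if v \in s then c v else 0.
pose d' v := if v \in t then d v else 0.
exists (undup (s ++ t)), (fun v => a * c' v + d' v); split.
- exact: undup_uniq.
- by move=> v /=; rewrite mem_undup mem_cat => /orP[/sS|/tS].
- have -> : \sum_(v <- s) c v *: v = \sum_(v <- s) c' v *: v.
    by apply: eq_big_seq => v vs; rewrite /c' vs.
  have -> : \sum_(v <- t) d v *: v = \sum_(v <- t) d' v *: v.
    by apply: eq_big_seq => v vt; rewrite /d' vt.
  have u := undup_uniq (s ++ t).
  rewrite (combsE us u) => [|v vs|v /negbTE vs]; last 2 first.
  - by rewrite mem_undup mem_cat vs.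
  - by rewrite /c' vs.
  rewrite (combsE ut u) => [|v vs|v /negbTE vs]; last 2 first.
  - by rewrite mem_undup mem_cat vs orbT.
  - by rewrite /d' vs.
  rewrite scaler_sumr -big_split; apply: eq_bigr => v _ /=.
  by rewrite scalerA scalerDl.
Qed.

Lemma lin_indep_mod (B C : set V) (s : seq V) (c : V -> F) :
    lin_indep B -> C `<=` B -> uniq s -> [set` s] `<=` B ->
    submodule_set (span C) (\sum_(v <- s) c v *: v) ->
  forall v, v \in s -> ~ C v -> c v = 0.
Proof.
move=> Bfree CB us sB; rewrite span_combs => -[t [d [ut tC e]]] v vs nCv.
pose c' v := if v \in s then c v else 0.
pose d' v := if v \in t then d v else 0.
have u := undup_uniq (s ++ t).
have := Bfree (undup (s ++ t)) (fun v => c' v - d' v) u.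
have -> : c v = c' v - d' v.
  rewrite /c' /d' vs; case: ifPn => [vt|]; last by rewrite subr0.
  by case: nCv; apply: tC.
apply; last by rewrite mem_undup mem_cat vs.
  by move=> w /=; rewrite mem_undup mem_cat => /orP[/sB|/tC/CB].
under eq_bigr do rewrite scalerBl.
rewrite sumrB -(combsE us u) => [|w vw|w /negbTE vw]; last 2 first.
- by rewrite mem_undup mem_cat vw.
- by rewrite /c' vw.
rewrite -(combsE ut u) => [|w vw|w /negbTE vw]; last 2 first.
- by rewrite mem_undup mem_cat vw orbT.
- by rewrite /d' vw.
apply/eqP; rewrite subr_eq0; apply/eqP.
transitivity (\sum_(v <- s) c v *: v).
  by apply: eq_big_seq => w vw; rewrite /c' vw.
by rewrite e; apply: eq_big_seq => w vw; rewrite /d' vw.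
Qed.

Lemma has_dim_quot (B C D : set V) (I : Type) :
    lin_indep B -> C `<=` D -> D `<=` B -> D `\` C #= [set: I] ->
  has_dim (quotproj (span C) @` span D) I.
Proof.
move=> Bfree CD DB DCI; have CB := subset_trans CD DB.
pose p := quotproj (span C).
have pinj : {in D `\` C &, injective p}.
  move=> x y; rewrite !inE => -[Dx nCx] [Dy nCy] /eq_quotmod xy.
  apply: contrapT => /eqP nxy.
  have nyx : (y == x) = false by rewrite eq_sym; exact/negbTE.
  pose c v : F := if v == x then 1 else -1.
  suff /eqP : c x = 0 by rewrite /c eqxx oner_eq0.
  apply: (@lin_indep_mod B C [:: x; y] c) => //.
  - by rewrite /= inE nxy.
  - by move=> v /=; rewrite !inE => /orP[] /eqP ->; apply: DB.
  - by rewrite big_cons big_seq1 /c eqxx nyx scale1r scaleN1r.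
  - by rewrite inE eqxx.
exists (p @` (D `\` C)); split.
- move=> s c us sB s0.
  have [t [tD es]] : exists t, [set` t] `<=` D `\` C /\ s = map p t.
    elim: s sB {us s0} => [|x s IHs] sB; first by exists [::]; split.
    have [y Dy yE] := sB x (mem_head _ _).
    have [|t [tD ->]] := IHs.
      by move=> z zs; apply: sB; rewrite /= inE zs orbT.
    exists (y :: t); rewrite -yE; split=> // z /=.
    by rewrite inE => /predU1P[->//|/tD].
  move: us s0; rewrite {}es big_map => /map_uniq ut t0 _ /mapP[x xt ->].
  apply: (@lin_indep_mod B C t (c \o p)) => //.
  + by move=> v /tD[/DB].
  + have : p (\sum_(v <- t) (c \o p) v *: v) = p 0.
      rewrite /p linear_sum linear0 -[RHS]t0.
      by apply: eq_bigr => v _; rewrite linearZ.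
    by move/eq_quotmod; rewrite subr0.
  + by have [] := tD _ xt.
- rewrite -image_span; apply/seteqP; split.
    move=> _ [x xDC <-]; exists x => //.
    by move=> M [Msub DM]; apply: xDC; split=> // y [/DM].
  move=> _ [x + <-]; rewrite span_combs => -[s [c [us sD ->]]].
  exists (\sum_(v <- s | v \notin C) c v *: v).
    have /is_submoduleP[S0 Slin] := submodule_closed (span (D `\` C)).
    rewrite big_seq_cond.
    elim/big_rec: _ => [//|v x' /andP[vs nCv] Sx]; apply: Slin => //.
    apply: sub_gen_smallest; split; first exact: sD.
    by move=> Cv; rewrite mem_set in nCv.
  apply/esym/eq_quotmod; rewrite (bigID (fun v => v \in C)) /= addrK.
  have /is_submoduleP[S0 Slin] := submodule_closed (span C).
  elim/big_rec: _ => [//|v x' /set_mem Cv Sx]; apply: Slin => //.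
  exact: sub_gen_smallest.
- by apply: card_eq_trans DCI; apply: inj_card_eq.
Qed.

Lemma lin_indepS (B C : set V) : lin_indep B -> C `<=` B -> lin_indep C.
Proof. by move=> Bfree CB s c us sC; apply: Bfree => // v /sC/CB. Qed.

Lemma span_setI (B C D : set V) : lin_indep B -> C `<=` B -> D `<=` B ->
  submoduleI (span C) (span D) = span (C `&` D).
Proof.
move=> Bfree CB DB; apply/submodule_inj/seteqP; split; last first.
  move=> x xCD; split=> M [Msub SM]; apply: xCD; split=> // y [Cy Dy];
  exact: SM.
move=> x [+ Dx]; rewrite span_combs => -[s [c [us sC xE]]].
rewrite {}xE in Dx *.
have /is_submoduleP[S0 Slin] := submodule_closed (span (C `&` D)).
rewrite big_seq; elim/big_rec: _ => [//|v x' vs Sx].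
have [Dv|nDv] := pselect (D v).
  apply: Slin => //; apply: sub_gen_smallest; split=> //; exact: sC.
rewrite (@lin_indep_mod B D s c) ?scale0r ?add0r// => w /sC; exact: CB.
Qed.

Lemma exists_adjacent (I I' : Type) : inhabited I -> inhabited I' ->
    has_dim [set: V] (I + I')%type ->
  exists L L' : Gr V I I', adjacent L L'.
Proof.
move=> [i0] [i0'] [B [Bfree BV BI]].
have [b b_inj bB] : exists2 b : I + I' -> V, injective b & b @` setT = B.
  pose V' : pointedType := HB.pack_for pointedType (V : choiceType) (isPointed.Build V 0).
  move: BI; rewrite card_eq_sym => BI.
  have /(@card_set_bijP _ V' _ B)[b [bfun binj bsurj]] := BI.
  exists b; first by move=> x y; apply: binj; rewrite inE.
  by apply/seteqP; split=> // _ [x _ <-]; exact: bfun.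
pose t (x : I + I') : I + I' := match x with
  | inl i => if `[< i = i0 >] then inr i0' else inl i
  | inr j => if `[< j = i0' >] then inl i0 else inr j end.
have tK : involutive t.
  move=> [i|j] /=; case: asboolP => [->|n] /=; case: asboolP => //.
have dims (u : I + I' -> I + I') (S := (b \o u \o inl) @` [set: I]) :
    involutive u -> [/\ S `<=` B, has_dim (span S) I &
                      has_dim [set: quotmod (span S)] I'].
  move=> uK; have buinj : injective (b \o u).
    by apply: inj_comp => //; exact: inv_inj.
  have SB : S `<=` B by move=> _ [i _ <-]; rewrite -bB; exists (u (inl i)).
  split=> //.
    exists S; split=> //; first exact: lin_indepS SB.
    by apply: inj_card_eq => i j _ _ /buinj[].
  have -> : [set: quotmod (span S)] = quotproj (span S) @` span B.
    rewrite BV; apply/esym/seteqP; split=> // y _.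
    by exists (repr y); rewrite ?quotprojK.
  apply: (has_dim_quot Bfree) => //.
  have -> : B `\` S = (b \o u \o inr) @` [set: I'].
    rewrite -bB; apply/seteqP; split.
      move=> _ [[x _ <-] nS]; case uxE : (u x) => [i|j].
        by case: nS; exists i => //=; rewrite -uxE uK.
      by exists j => //=; rewrite -uxE uK.
    move=> _ [j _ <-]; split; first by exists (u (inr j)).
    by move=> [i _ /buinj].
  by apply: inj_card_eq => i j _ _ /buinj[].
have [SB Sd Sc] := dims id (fun=> erefl).
have [S'B S'd S'c] := dims t tK.
set S := _ @` _ in SB Sd Sc; set S' := _ @` _ in S'B S'd S'c.
have unit1 (x : V) (C : set V) : C = [set x] -> C #= [set: unit].
  move=> ->; rewrite (_ : [set x] = (fun=> x) @` [set: unit]).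
    by apply: inj_card_eq => -[] [].
  by apply/seteqP; split=> [_ ->|_ [_ _ <-]] //; exists tt.
exists (MkGr Sd Sc), (MkGr S'd S'c); rewrite /adjacent /=.
rewrite (span_setI Bfree SB S'B); split; apply: (has_dim_quot Bfree) => //.
- apply: (unit1 (b (inl i0))); apply/seteqP; split.
    move=> _ [[i _ <-] /= nS]; congr (b (inl _)); apply: contrapT => ni.
    by apply: nS; split; exists i => //=; case: asboolP.
  move=> _ ->; split; first by exists i0.
  by move=> [_ [i _ /b_inj]] /=; case: asboolP => // n [].
- apply: (unit1 (b (inr i0'))); apply/seteqP; split.
    move=> _ [[i _ <-] /=]; case: asboolP => // ni nS; case: nS.
    by split; exists i => //=; case: asboolP.
  move=> _ ->; split; first by exists i0 => //=; case: asboolP.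
  by move=> [[i _ /b_inj]].
Qed.
End AdjacentPairs.

Section Representations.
Variables (G : Type) (A : nzRingType) (U : lmodType A) (act : G -> U -> U).

Definition subrep (N : set U) : Prop :=
  is_submodule N /\ forall g x, N x -> N (act g x).

Definition irreducible (N : set U) : Prop :=
  [/\ subrep N, N <> [set 0] &
      forall N', subrep N' -> N' `<=` N -> N' = [set 0] \/ N' = N].

End Representations.

Section QuotientRepresentation.
Variables (A : nzRingType) (U : lmodType A) (W : submodule U).
Variables (G : Type) (act : G -> U -> U).

(* The choice of repr x is irrelevant when act is additive and W is a *)
(* subrepresentation, see quot_actE.                                  *)
Definition quot_act (g : G) (x : quotmod W) : quotmod W :=
  quotproj W (act g (repr x)).

Lemma quot_actE (g : G) (x : U) :
  subrep act W -> {morph act g : y z / y - z} ->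
  quot_act g (quotproj W x) = quotproj W (act g x).
Proof.
move=> [_ stW] actB; apply/eq_quotmod; rewrite -actB; apply: stW.
by apply/eq_quotmod; rewrite reprK.
Qed.

End QuotientRepresentation.

Definition zero_sum (A : nzRingType) (T : choiceType) : set {freeg T / A} :=
  [set x | \sum_(t <- dom x) coeff t x = 0].

Section FormalCombinations.
Variables (F : nzRingType) (V : lmodType F) (I I' : Type).
Local Notation Gr := (Gr V I I').

Definition free_act (A : nzRingType) (g : GL V) :
    {freeg Gr / A} -> {freeg Gr / A} :=
  fglift (fun L : Gr => << gr_act g L >>).

Fact free_actB (A : nzRingType) (g : GL V) :
  {morph @free_act A g : x y / x - y}.
Proof. exact: lift_is_additive. Qed.

(* M1 is generated by the single difference [L] - [L'], for adjacent L and L' *)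
(* (such pairs exist by exists_adjacent).                                     *)
Definition M1 (L L' : Gr) : set {freeg Gr / int} :=
  smallest (subrep (@free_act int)) [set << L >> - << L' >>].

Definition base_change (K : nzRingType) (x : {freeg Gr / int}) :
    {freeg Gr / K} :=
  \sum_(L <- dom x) << (coeff L x)%:~R *g L >>.

(* The tensor product of K and M1 over the integers, identified with its *)
(* image in K[Gr], that is the K-span of the image of M1.                *)
Definition KM1 (K : nzRingType) (L L' : Gr) : submodule {freeg Gr / K} :=
  span (base_change K @` M1 L L').

End FormalCombinations.

Arguments free_act {F V I I'} A g x.
Arguments zero_sum A T _ : clear implicits.
Arguments base_change {F V I I'} K x.
Arguments KM1 {F V I I'} K L L'.
Arguments quot_act {A U} W {G} act g x.

(* Main.v *)
Require Import Defs.
From mathcomp Require Import all_boot all_algebra.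
From mathcomp Require Import boolp classical_sets cardinality.
From mathcomp Require Import freeg.
From HB Require Import structures.
From mathcomp Require Import functions.

(** Why the theorem is true.

    Write N for a nonzero subrepresentation of K[Gr]. Everything rests on
    finding in N one difference [P] - [Q] of neighbours, that is of two
    subspaces A + Fp and A + Fq sharing the hyperplane A. Since GL(V) permutes
    the ordered pairs of neighbours transitively ([GL_transitive_neighbours]),
    N then contains the generator of the representation spanned by M1.

    Reduction to a projective line. If x lies in N and g is a transvection,
    g x - x loses every member of the support of x fixed by g. Grouping the
    members of Gr into classes preserved by suitable transvections, one can so
    destroy all classes but one ([isolate_class]); the infinite field provides
    transvections that move the members of the surviving class off one
    another, so that the result is not zero. Two such sweeps are made. First
    the class of P is P + Fv, for v in no member of the support, and the survivors are
    hyperplanes of one space B. Then the class of P is its trace on the kernel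
    of a functional, and the survivors all contain a common A. What is left
    is a nonzero y in N supported on the pencil of the P with A < P < B, a
    projective line over F ([reduce_to_pencil]).

    The projective line. Choose a point of the pencil as point at infinity so
    that the sum of the other coefficients b_i of y is not zero: outside the
    support if y has a nonzero total, inside it otherwise. Let f(t) be the class
    in K[Gr]/N of the point with coordinate t. The affine group of the line
    gives, for all b and all c <> 0,
        sum_i b_i f(b + w_i c) = e.
    Varying b and c together so that one argument stays fixed removes the terms
    one at a time, as in Frechet's treatment of polynomials, so all iterated
    differences of f of some order vanish ([functional_equation_diffs]).
    Now apply an iterated difference of order k >= 1 to the same relation with
    c = 1, when those of order k + 1 vanish: every term becomes the same value,
    multiplied by the nonzero sum of the b_i, whence order k vanishes too
    ([diffs_vanish_descent]). So f is constant, and [P] - [Q] is in N for two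
    points of the pencil, which are neighbours.

    The equivalences. A shear x + phi(x) w moves a subspace to itself or to a
    neighbour. If the dimension or the codimension is finite, members of Gr are
    moved to each other by finite products of shears, step by step along flags
    ([finite_transitive]), so the neighbour differences generate all
    combinations with sum zero. If both are infinite, being contained in L up
    to a finite dimensional defect is a property shared by neighbours but not
    by all members of Gr, and it yields a linear form which vanishes on the span
    of M1 and not on all combinations with sum zero ([KM1_neq_zero_sum]). The
    remaining implications follow since K[Gr] modulo the combinations with sum
    zero is the trivial representation. *)

Local Open Scope classical_set_scope.
Local Open Scope ring_scope.

Set Implicit Arguments.
Unset Strict Implicit.
Unset Printing Implicit Defensive.

Import GRing.Theory.
Local Notation span := Defs.span.

(** * Submodules and linear maps *)

(** Lets W x express membership in the submodule W. *)
Definition contains (R : nzRingType) (V : lmodType R) (W : submodule V) : V -> Prop :=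
  submodule_set W.
Coercion contains : submodule >-> Funclass.

Section SubmoduleTheory.
Variables (R : nzRingType) (V : lmodType R).
Implicit Types (W U : submodule V) (x y v : V).

Lemma sub_lin W a x y : W x -> W y -> W (a *: x + y).
Proof. by have /is_submoduleP[_] := submodule_closed W; apply. Qed.

Lemma sub_zero W : W 0.
Proof. by have /is_submoduleP[] := submodule_closed W. Qed.

Lemma sub_scale W a x : W x -> W (a *: x).
Proof. by move=> Wx; rewrite -[_ *: _]addr0; apply/sub_lin/sub_zero. Qed.

Lemma sub_add W x y : W x -> W y -> W (x + y).
Proof. by move=> Wx Wy; rewrite -[x]scale1r; apply: sub_lin. Qed.

Lemma sub_opp W x : W x -> W (- x).
Proof. by move=> Wx; rewrite -scaleN1r; apply: sub_scale. Qed.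

Lemma sub_diff W x y : W x -> W y -> W (x - y).
Proof. by move=> Wx Wy; apply/sub_add/sub_opp. Qed.

Lemma sub_sum W (T : Type) (s : seq T) (P : pred T) (f : T -> V) :
  (forall i, P i -> W (f i)) -> W (\sum_(i <- s | P i) f i).
Proof.
move=> Wf; elim/big_rec: _ => [|i x Pi Wx]; first exact: sub_zero.
by apply: sub_add => //; apply: Wf.
Qed.

Lemma sub_sum_seq W (T : eqType) (s : seq T) (f : T -> V) :
  (forall i, i \in s -> W (f i)) -> W (\sum_(i <- s) f i).
Proof. by move=> Wf; rewrite big_seq; apply: sub_sum. Qed.

Lemma span_sub (S : set V) W : S `<=` W -> span S `<=` W.
Proof. by apply: smallest_sub; apply: submodule_closed. Qed.

Lemma span_gen (S : set V) : S `<=` span S.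
Proof. exact: sub_gen_smallest. Qed.

Lemma span_mono (S T : set V) : S `<=` T -> span S `<=` span T.
Proof. by move=> ST; apply: span_sub => x /ST; apply: span_gen. Qed.

Lemma adjoin_is_submodule W v : is_submodule [set x | exists a, W (x - a *: v)].
Proof.
apply/is_submoduleP; split=> [|a x y [b Wb] [c Wc]].
  by exists 0; rewrite scale0r subr0; apply: sub_zero.
exists (a * b + c); rewrite scalerDl opprD addrACA -scalerA -scalerBr.
exact: sub_lin.
Qed.

Definition adjoin W v : submodule V := Submodule (adjoin_is_submodule W v).

Lemma adjoinP W v x : adjoin W v x <-> exists w a, W w /\ x = w + a *: v.
Proof.
split=> [[a Wa]|[w [a [Ww ->]]]]; last by exists a; rewrite addrK.
by exists (x - a *: v), a; rewrite subrK.
Qed.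

Lemma adjoin_base W v : W `<=` adjoin W v.
Proof. by move=> x Wx; exists 0; rewrite scale0r subr0. Qed.

Lemma adjoin_mem W v : adjoin W v v.
Proof. by exists 1; rewrite scale1r subrr; apply: sub_zero. Qed.

Lemma adjoin_sub W U v : W `<=` U -> U v -> adjoin W v `<=` U.
Proof.
move=> WU Uv x [a Wa]; rewrite -[x](subrK (a *: v)).
by apply: sub_add; [apply: WU | apply: sub_scale].
Qed.

Lemma submodule_ext W U : (forall x, W x <-> U x) -> W = U.
Proof. by move=> e; apply: submodule_inj; apply/seteqP; split=> x /e. Qed.

End SubmoduleTheory.

Lemma exists_linear (R : nzRingType) (U V : lmodType R) (f : U -> V) :
  linear f -> exists g : {linear U -> V}, forall x, g x = f x.
Proof.
move=> f_lin; pose m := GRing.isLinear.Build R U V *:%R f f_lin.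
by exists (HB.pack_for {linear U -> V} f m).
Qed.

(** * Functionals and shears over a division ring *)

Section DivisionRing.
Variables (F : unitRingType) (V : lmodType F).
Hypothesis divF : forall a : F, a != 0 -> a \is a GRing.unit.
Implicit Types (W U A L : submodule V) (x y v : V).

Lemma mulfVl (a : F) : a != 0 -> a^-1 * a = 1.
Proof. by move=> /divF; apply: mulVr. Qed.

Lemma mulfVr (a : F) : a != 0 -> a * a^-1 = 1.
Proof. by move=> /divF; apply: mulrV. Qed.

Lemma mul_neq0 (a b : F) : a != 0 -> b != 0 -> a * b != 0.
Proof.
by move=> a0; apply: contra_neq => ab0; rewrite -[b]mul1r -(mulfVl a0) -mulrA ab0 mulr0.
Qed.

Lemma sub_scaleK W a v : a != 0 -> W (a *: v) -> W v.
Proof.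
by move=> a0 Wav; rewrite -[v]scale1r -(mulfVl a0) -scalerA; apply: sub_scale.
Qed.

Lemma adjoin_exchange W v x : adjoin W v x -> ~ W x -> adjoin W x = adjoin W v.
Proof.
move=> /adjoinP[w [a [Ww xE]]] nWx.
have a0 : a != 0.
  by apply: contra_notN nWx => /eqP a0; rewrite xE a0 scale0r addr0.
apply: submodule_inj; apply/seteqP; split; apply: adjoin_sub.
- exact: adjoin_base.
- by apply/adjoinP; exists w, a.
- exact: adjoin_base.
- apply: (sub_scaleK a0); rewrite -[a *: v](addKr w) -xE.
  by apply: sub_add; [apply: sub_opp; apply: adjoin_base|apply: adjoin_mem].
Qed.

(** Zorn's lemma. The empty chain is the reason for maximizing X in the
    union of W and X rather than the submodule itself. *)
Lemma exists_maximal_avoiding W v : ~ W v ->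
  exists H : submodule V, [/\ W `<=` H, ~ H v & forall x, ~ H x -> adjoin H x v].
Proof.
move=> nWv.
pose good (X : set V) := is_submodule (W `|` X) /\ ~ (W `|` X) v.
have good0 X : X = set0 -> good X.
  by move=> ->; rewrite /good setU0; split=> //; apply: submodule_closed.
have [|X [[Xsub nXv] Xmax]] := @Zorn_bigcup V good.
  move=> FF Fgood Ftot; have [[Y FY]|F0] := pselect (exists Y, FF Y); last first.
    apply: good0; apply/seteqP; split=> // x [Y FY].
    by case: F0; exists Y.
  split.
    have mem_union x : (W `|` \bigcup_(X in FF) X) x -> exists2 X, FF X & (W `|` X) x.
      by move=> [Wx|[X FX Xx]]; [exists Y => //; left|exists X => //; right].
    apply/is_submoduleP; split; first by left; apply: sub_zero.
    move=> a x y /mem_union[X1 FX1 X1x] /mem_union[X2 FX2 X2y].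
    have [X3 FX3 [X3x X3y]] : exists2 X3, FF X3 & (W `|` X3) x /\ (W `|` X3) y.
      have [X12|X21] := Ftot _ _ FX1 FX2.
        by exists X2 => //; split=> //; apply: setUS X1x.
      by exists X1 => //; split=> //; apply: setUS X2y.
    have /is_submoduleP[_ lin3] := (Fgood _ FX3).1.
    by have [?|?] := lin3 a x y X3x X3y; [left|right; exists X3].
  move=> [//|[X FX Xv]]; have [_] := Fgood _ FX.
  by apply; right.
exists (Submodule Xsub); split=> [x Wx|//|x nHx]; first by left.
apply: contrapT => nv; pose H := adjoin (Submodule Xsub) x.
have WH : W `|` H = H.
  by apply/setUidPr => y Wy; apply: adjoin_base; left.
case: (Xmax H).
  split.
    by move=> y Xy; apply: adjoin_base; right.
  by move=> HX; apply: nHx; right; apply: HX; apply: adjoin_mem.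
by rewrite /good WH; split=> //; apply: submodule_closed.
Qed.

(** A submodule H maximal among those avoiding v is a complement of Fv, so the
    coordinate along v is a linear form. *)
Lemma exists_functional W v : ~ W v ->
  exists phi : {linear V -> F^o}, (forall w, W w -> phi w = 0) /\ phi v = 1.
Proof.
move=> /exists_maximal_avoiding[H [WH nHv Hmax]].
have dec x : exists a, H (x - a *: v).
  have [Hx|nHx] := pselect (H x); first by exists 0; rewrite scale0r subr0.
  suff : adjoin H v x by [].
  by rewrite (adjoin_exchange (Hmax _ nHx) nHv); apply: adjoin_mem.
have [f fP] := choice dec.
have funiq x a : H (x - a *: v) -> f x = a.
  move=> Ha; apply/eqP; rewrite -subr_eq0; apply: contra_notT nHv => fa.
  apply: (sub_scaleK fa); rewrite scalerBl.
  by have := sub_diff Ha (fP x); rewrite opprB addrC addrA subrK.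
have flin : linear (f : V -> F^o).
  move=> a x y; apply: funiq.
  rewrite scalerDl opprD addrACA -scalerA -scalerBr.
  exact: sub_lin.
have [phi phiE] := exists_linear flin; exists phi; split=> [w Ww|].
  by rewrite phiE; apply: funiq; rewrite scale0r subr0; apply: WH.
by rewrite phiE; apply: funiq; rewrite scale1r subrr; apply: sub_zero.
Qed.

(** The scalar stands on the right: linear forms on a left vector space are a
    right vector space, and F may be noncommutative. *)
Lemma exists_functional_comb (phi psi : {linear V -> F^o}) (c : F) :
  exists chi : {linear V -> F^o}, forall x, chi x = phi x + psi x * c.
Proof.
apply: exists_linear => a x y.
rewrite !linearP -[_ *: psi x]/(a * psi x : F) mulrDl scalerDr addrACA.
by rewrite -mulrA.
Qed.

Lemma kernel_is_submodule (phi : {linear V -> F^o}) : is_submodule [set x | phi x = 0].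
Proof.
apply/is_submoduleP; split=> [|a x y /= x0 y0]; first exact: linear0.
by rewrite linearP x0 y0 scaler0 addr0.
Qed.

Definition kernel (phi : {linear V -> F^o}) := Submodule (kernel_is_submodule phi).

Lemma adjoin_kernel_trace (phi : {linear V -> F^o}) W v : W v -> phi v != 0 ->
  W = adjoin (submoduleI W (kernel phi)) v /\ ~ submoduleI W (kernel phi) v.
Proof.
move=> Wv phiv; split; last by move=> [_ /eqP]; rewrite (negbTE phiv).
apply/submodule_inj/seteqP; split; last by apply: adjoin_sub => // z [].
move=> z Wz; exists (phi z * (phi v)^-1); split; first exact/sub_diff/sub_scale.
rewrite /= linearB [phi (_ *: v)]linearZ_LR /=.
by rewrite -[_ *: phi v]/(phi z * (phi v)^-1 * phi v : F) -mulrA mulfVl// mulr1 subrr.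
Qed.

(** Transvections when phi w = 0, dilations otherwise. Apart from the
    automorphisms prescribed on bases, only composites of these are used. *)
Definition is_shear (g : GL V) : Prop :=
  exists (phi : {linear V -> F^o}) w, forall x, g x = x + phi x *: w.

(** The inverse is again of this form, with w replaced by
    - (1 + phi w)^-1 w. *)
Lemma exists_shear (phi : {linear V -> F^o}) (w : V) : 1 + phi w != 0 ->
  exists g : GL V, forall x, g x = x + phi x *: w.
Proof.
move=> u0; set u := 1 + phi w in u0.
have shear_lin z : linear (fun x => x + phi x *: z).
  by move=> a x y; rewrite linearP scalerDl scalerDr addrACA scalerA.
have [g gE] := exists_linear (shear_lin w).
have gbij : bijective g.
  exists (fun x => x + phi x *: (- u^-1 *: w)) => x; rewrite gE.
    rewrite linearD linearZ_LR /= -addrA; set c := phi x.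
    rewrite -[RHS]addr0; congr (_ + _).
    have -> : c + c *: (phi w : F^o) = c * u by rewrite /u mulrDr mulr1.
    by rewrite !scalerA -mulrA mulrN mulfVr// mulrN1 -scalerDl subrr scale0r.
  rewrite linearD linearZ_LR linearZ_LR /= -addrA; set c := phi x.
  rewrite -[RHS]addr0; congr (_ + _).
  rewrite [c *: (_ *: w)]scalerA -scalerDl -[_ *: (- u^-1 *: _)]/(c * (- u^-1 * phi w) : F).
  rewrite -[X in _ + (X + _)](mulr1 c) -!mulrDr.
  suff -> : - u^-1 + (1 + - u^-1 * phi w) = 0 by rewrite mulr0 scale0r.
  have uE : u^-1 + u^-1 * phi w = 1 by rewrite -[X in X + _]mulr1 -mulrDr mulfVl.
  by rewrite addrCA !mulNr -opprD uE subrr.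
by exists (MkGL gbij).
Qed.

Lemma exists_transvection (phi : {linear V -> F^o}) (w : V) : phi w = 0 ->
  exists g : GL V, forall x, g x = x + phi x *: w.
Proof. by move=> w0; apply: exists_shear; rewrite w0 addr0 oner_neq0. Qed.

End DivisionRing.

(** * General position over an infinite division ring *)

Section Generic.
Variables (F : unitRingType) (V : lmodType F).
Hypothesis divF : forall a : F, a != 0 -> a \is a GRing.unit.
Hypothesis infF : infinite_set [set: F].
Implicit Types (W U A L : submodule V) (x y v : V).

Lemma exists_notin (s : seq F) : exists t, t \notin s.
Proof.
apply: contrapT => ns; apply: infF; apply/finite_seqP; exists s.
apply/seteqP; split=> // t _ /=; apply: contrapT => /negP nt.
by apply: ns; exists t.
Qed.

(** The form in which the infinity of F is used: a finite set of conditions,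
    each excluding at most one scalar, can be met together. *)
Lemma exists_avoiding (T : eqType) (s : seq T) (P : T -> F -> Prop) :
  (forall x : T, x \in s -> exists b, forall t, t != b -> P x t) ->
  exists t, forall x : T, x \in s -> P x t.
Proof.
move=> bad.
have [c cP] : exists c : seq F, forall t, t \notin c -> forall x : T, x \in s -> P x t.
  elim: s bad => [|x s IHs] bad; first by exists [::].
  have [|c cP] := IHs; first by move=> y ys; apply: bad; rewrite inE ys orbT.
  have [b bP] := bad x (mem_head _ _).
  exists (b :: c) => t; rewrite inE negb_or => /andP[tb tc] y.
  by rewrite inE => /predU1P[->|]; [apply: bP|apply: cP].
by have [t tc] := exists_notin c; exists t; apply: cP.
Qed.

(** The difference of the two points is a multiple of u. *)
Lemma affine_line_meets W u v t t' : ~ W u -> W (v + t *: u) -> W (v + t' *: u) ->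
  t = t'.
Proof.
move=> nWu Wt Wt'; apply/eqP; rewrite -subr_eq0; apply: contra_notT nWu => tt'.
apply: (sub_scaleK divF tt'); rewrite scalerBl.
by have := sub_diff Wt Wt'; rewrite opprD addrACA subrr add0r.
Qed.

(** A finite union of proper subspaces is not the whole space: given v outside
    all but one of them and u outside the last, some v + t u is outside all. *)
Lemma exists_generic_vector (T : eqType) (s : seq T) (W : T -> submodule V) :
  (forall i, i \in s -> exists u, ~ W i u) -> exists v, forall i, i \in s -> ~ W i v.
Proof.
elim: s => [|j s IHs] Wproper; first by exists 0.
have [|v vP] := IHs; first by move=> i si; apply: Wproper; rewrite inE si orbT.
have [u nWu] := Wproper j (mem_head _ _).
have [i si|t tP] := @exists_avoiding T (j :: s) (fun i t => ~ W i (v + t *: u)).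
  have [Wiu|nWiu] := pselect (W i u).
    exists 0 => t _ Wt; have Wv : W i v.
      by rewrite -[v](addrK (t *: u)); apply/sub_diff/sub_scale.
    by move: si Wv Wiu; rewrite inE => /predU1P[->|/vP].
  have [[b Wb]|nWb] := pselect (exists b, W i (v + b *: u)); last first.
    by exists 0 => t _ Wt; apply: nWb; exists t.
  by exists b => t /eqP tb Wt; apply/tb/(affine_line_meets nWiu Wt Wb).
by exists (v + t *: u).
Qed.

(** The dual of [exists_generic_vector], by the same pencil argument. *)
Lemma exists_generic_functional A (s : seq V) : (forall v, v \in s -> ~ A v) ->
  exists phi : {linear V -> F^o}, (forall a, A a -> phi a = 0) /\
    forall v, v \in s -> phi v != 0.
Proof.
elim: s => [|x s IHs] nA.
  have zero_lin : linear ((fun=> 0) : V -> F^o) by move=> a x y; rewrite scaler0 addr0.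
  have [phi phiE] := exists_linear zero_lin.
  by exists phi.
have [|phi [phiA phis]] := IHs; first by move=> y ys; apply: nA; rewrite inE ys orbT.
have [psi [psiA psix]] := exists_functional divF (nA x (mem_head _ _)).
have [y ys|t tP] := @exists_avoiding V (x :: s) (fun y t => phi y + psi y * t != 0).
  have [psiy0|psiy] := eqVneq (psi y) 0.
    exists 0 => t _; rewrite psiy0 mul0r addr0; apply: phis.
    move: ys; rewrite inE => /predU1P[yx|//].
    by have := oner_neq0 F; rewrite -psix -yx psiy0 eqxx.
  exists (- ((psi y)^-1 * phi y)) => t; apply: contraNneq => /eqP.
  rewrite addrC addr_eq0 => /eqP e; apply/eqP.
  by rewrite -[t]mul1r -(mulfVl divF psiy) -mulrA e mulrN.
have [chi chiE] := exists_functional_comb phi psi t.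
exists chi; split=> [a Aa|y ys]; first by rewrite chiE phiA// psiA// mul0r addr0.
by rewrite chiE; apply: tP.
Qed.

(** With phi zero on A, phi q = 1 and phi q' nonzero, the shear along q' - q is
    invertible because 1 + phi (q' - q) = phi q'. *)
Lemma shear_replaces_vector A q q' : ~ A q -> ~ A q' ->
  exists g : GL V, [/\ is_shear g, forall a, A a -> g a = a & g q = q'].
Proof.
move=> nAq nAq'.
have [|phi [phiA phi0]] := @exists_generic_functional A [:: q; q'].
  by move=> v; rewrite !inE => /orP[]/eqP->.
have phiq : phi q != 0 by apply: phi0; rewrite inE eqxx.
have phiq' : phi q' != 0 by apply: phi0; rewrite !inE eqxx orbT.
have [chi chiE] := exists_functional_comb phi phi ((phi q)^-1 - 1).
have {chiE} chiE x : chi x = phi x * (phi q)^-1.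
  by rewrite chiE mulrDr mulrN1 addrC subrK.
have chiq : chi q = 1 by rewrite chiE mulfVr.
have [|g gE] := @exists_shear _ _ divF chi (q' - q).
  rewrite linearB /= chiq addrC subrK chiE; apply: (mul_neq0 divF) => //.
  by apply: contraNneq phiq => /(congr1 GRing.inv); rewrite invrK invr0 => ->.
exists g; split; first by exists chi, (q' - q).
  by move=> a Aa; rewrite gE chiE phiA// mul0r scale0r addr0.
by rewrite gE chiq scale1r addrC subrK.
Qed.

(** For p in L outside both hyperplanes let f1, f2 be the functionals with
    kernels A1, A2 on L and value 1 at p. Then x |-> x + (f1 - f2)(x) p is a
    transvection which restricts on A1 to the projection onto A2 along p. *)
Lemma shear_replaces_hyperplane L A1 A2 p1 p2 :
    L = adjoin A1 p1 -> ~ A1 p1 -> L = adjoin A2 p2 -> ~ A2 p2 ->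
  exists g : GL V, [/\ is_shear g, g @` L = L & g @` A1 = A2].
Proof.
move=> L1 nA1 L2 nA2.
(* No vector space is the union of two proper subspaces: p1, p2 or p1 + p2. *)
have [p [Lp nA1p nA2p]] : exists p, [/\ L p, ~ A1 p & ~ A2 p].
  have Lp1 : L p1 by rewrite L1; apply: adjoin_mem.
  have Lp2 : L p2 by rewrite L2; apply: adjoin_mem.
  have [A2p1|] := pselect (A2 p1); last by exists p1.
  have [A1p2|] := pselect (A1 p2); last by exists p2.
  exists (p1 + p2); split; first exact: sub_add.
    by move=> /sub_diff/(_ A1p2); rewrite addrK.
  by move=> /sub_diff/(_ A2p1); rewrite addrAC subrr add0r.
have {nA1}L1 : L = adjoin A1 p by rewrite L1 (adjoin_exchange divF (v := p1) _ nA1p)// -L1.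
have {nA2}L2 : L = adjoin A2 p by rewrite L2 (adjoin_exchange divF (v := p2) _ nA2p)// -L2.
have [f1 [f1A f1p]] := exists_functional divF nA1p.
have [f2 [f2A f2p]] := exists_functional divF nA2p.
have kernel_trace A (f : {linear V -> F^o}) x : L = adjoin A p ->
    (forall a, A a -> f a = 0) -> f p = 1 -> L x -> f x = 0 -> A x.
  move=> -> fA fp /adjoinP[a [c [Aa ->]]].
  rewrite linearD linearZ_LR /= fA// fp add0r => c0.
  by rewrite -[c]mulr1 [c * 1]c0 scale0r addr0.
have [chi chiE] := exists_functional_comb f1 f2 (-1).
have {}chiE x : chi x = f1 x - f2 x by rewrite chiE mulrN1.
have chip : chi p = 0 by rewrite chiE f1p f2p subrr.
have [g gE] := exists_transvection divF chip.
have AL1 : A1 `<=` L by rewrite L1; apply: adjoin_base.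
have AL2 : A2 `<=` L by rewrite L2; apply: adjoin_base.
have invg x : g (x - chi x *: p) = x.
  by rewrite gE linearB [chi (_ *: p)]linearZ_LR /= chip scaler0 subr0 subrK.
exists g; split; first by exists chi, p.
  apply/seteqP; split=> [_ [x Lx <-]|x Lx].
    by rewrite gE; apply/sub_add/sub_scale.
  by exists (x - chi x *: p); [apply/sub_diff/sub_scale|apply: invg].
apply/seteqP; split=> [_ [x A1x <-]|x A2x].
  apply: (kernel_trace A2 f2 _ L2 f2A f2p).
    by rewrite gE; apply/sub_add/sub_scale => //; apply: AL1.
  rewrite gE linearD linearZ_LR /= chiE f1A// add0r f2p.
  by rewrite -[_ *: 1]/(- f2 x * 1 : F) mulr1 subrr.
exists (x - chi x *: p); last exact: invg.
apply: (kernel_trace A1 f1 _ L1 f1A f1p).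
  by apply/sub_diff/sub_scale => //; apply: AL2.
rewrite linearB [f1 (_ *: p)]linearZ_LR /= chiE f2A// subr0 f1p.
by rewrite -[_ *: 1]/(f1 x * 1 : F) mulr1 subrr.
Qed.

End Generic.

(** * Bases and transitivity of GL on the Grassmannian *)

Section Bases.
Variables (R : nzRingType).

Lemma lin_indep_notin_span (V : lmodType R) (B C : set V) v :
  lin_indep B -> C `<=` B -> B v -> ~ C v -> ~ span C v.
Proof.
move=> Bfree CB Bv nCv Cv; suff /eqP : (1 : R) = 0 by rewrite oner_eq0.
apply: (@lin_indep_mod _ _ B C [:: v] (fun=> 1)) nCv; rewrite ?inE//.
  by move=> x /=; rewrite inE => /eqP->.
by rewrite big_seq1 scale1r.
Qed.

Lemma lin_indep_neq0 (V : lmodType R) (B : set V) v : lin_indep B -> B v -> v <> 0.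
Proof.
move=> Bfree Bv v0; apply: (@lin_indep_notin_span _ B set0 v Bfree) => //.
by rewrite v0; apply: sub_zero.
Qed.

(** The graph of the extension is the span of the pairs (e, s e): it is total
    because E spans, and single valued because E is independent. *)
Lemma linear_extension (U V : lmodType R) (E : set V) (s : V -> U) :
  lin_indep E -> span E = [set: V] :> set V ->
  exists g : {linear V -> U}, forall e, E e -> g e = s e.
Proof.
move=> Efree ET; pose W := @span R (V * U)%type ((fun e => (e, s e)) @` E).
have W_total x : exists y, W (x, y).
  have : submodule_set (span E) x by rewrite ET.
  apply: (@smallest_sub _ (@is_submodule R V) E [set x | exists y, W (x, y)]); last first.
    by move=> e Ee; exists (s e); apply: span_gen; exists e.
  apply/is_submoduleP; split; first by exists 0; apply: sub_zero.
  by move=> a u v [u' Wu] [v' Wv]; exists (a *: u' + v'); apply: (sub_lin a Wu Wv).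
have W0 z : W (0, z) -> z = 0.
  rewrite /W /contains span_combs => -[l [c [ul lE e]]].
  have lP v : v \in l -> E v.1 /\ v = (v.1, s v.1) by move=> /lE[x Ex <-].
  have fst_inj : {in l &, injective fst}.
    by move=> u v /lP[_ ->] /lP[_ ->] /= ->.
  have sum1 (k : seq (V * U)) : (\sum_(v <- k) c v *: v).1 = \sum_(v <- k) c v *: v.1.
    by elim: k => [|v k IHk]; rewrite ?big_nil// !big_cons -IHk.
  have sum2 (k : seq (V * U)) : (\sum_(v <- k) c v *: v).2 = \sum_(v <- k) c v *: v.2.
    by elim: k => [|v k IHk]; rewrite ?big_nil// !big_cons -IHk.
  have c0 v : v \in l -> c v = 0.
    move=> vl; have [_ vE] := lP v vl; rewrite vE.
    apply: (Efree (map fst l) (fun e => c (e, s e))).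
    - by rewrite map_inj_in_uniq.
    - by move=> _ /mapP[u /lP[Eu _] ->].
    - rewrite big_map -[RHS]/((0 : V, z).1) e sum1.
      by apply: eq_big_seq => u /lP[_ uE]; congr (c _ *: _).
    - by apply: map_f.
  rewrite -[z]/((0 : V, z).2) e sum2 big_seq big1// => v /c0 ->.
  by rewrite scale0r.
have [f fP] := choice W_total.
have f_lin : linear f.
  move=> a x y; apply/eqP; rewrite -subr_eq0; apply/eqP/W0.
  have := sub_diff (fP (a *: x + y)) (sub_lin a (fP x) (fP y)).
  by rewrite -[(_, _) - _]/(_ - _, _ - _) subrr.
have [g gE] := exists_linear f_lin; exists g => e Ee.
rewrite gE; apply/eqP; rewrite -subr_eq0; apply/eqP/W0.
have We : W (e, s e) by apply: span_gen; exists e.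
by have := sub_diff (fP e) We; rewrite -[(_, _) - _]/(_ - _, _ - _) subrr.
Qed.

Lemma linear_eq_on_span (U V : lmodType R) (E : set V) (f g : {linear V -> U}) :
  (forall e, E e -> f e = g e) -> forall x, span E x -> f x = g x.
Proof.
move=> fg; apply: (@smallest_sub _ (@is_submodule R V) E [set x | f x = g x]) => //.
apply/is_submoduleP; split=> [|a u v /= fu fv]; first by rewrite /= !linear0.
by rewrite !linearP fu fv.
Qed.

Lemma GL_of_bases (V : lmodType R) (E E' : set V) (s t : V -> V) :
  lin_indep E -> span E = [set: V] :> set V ->
  lin_indep E' -> span E' = [set: V] :> set V ->
  (forall e, E e -> E' (s e) /\ t (s e) = e) ->
  (forall e, E' e -> E (t e) /\ s (t e) = e) ->
  exists g : GL V, forall e, E e -> g e = s e.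
Proof.
move=> Efree ET E'free E'T stE stE'.
have [g gE] := linear_extension s Efree ET.
have [h hE] := linear_extension t E'free E'T.
have gbij : bijective g.
  exists h => x.
    suff : (h \o g) x = (idfun : {linear V -> V}) x by [].
    apply: (@linear_eq_on_span _ _ E); last by rewrite /contains ET.
    by move=> e Ee /=; have [E's se] := stE e Ee; rewrite gE// hE// se.
  suff : (g \o h) x = (idfun : {linear V -> V}) x by [].
  apply: (@linear_eq_on_span _ _ E'); last by rewrite /contains E'T.
  by move=> e Ee /=; have [Es se] := stE' e Ee; rewrite hE// gE// se.
by exists (MkGL gbij).
Qed.

(** Bijections between subsets of one type as everywhere defined functions,
    which is the form in which they prescribe linear maps on bases. *)
Lemma card_eq_inverses (T : choiceType) (x0 : T) (A B : set T) : (A #= B)%card ->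
  exists s t : T -> T, (forall x, A x -> B (s x) /\ t (s x) = x) /\
                       (forall y, B y -> A (t y) /\ s (t y) = y).
Proof.
pose T' : pointedType := HB.pack_for pointedType T (isPointed.Build T x0).
move=> /(@ppcard_eqP T' T')[f]; exists f, f^-1%FUN; split.
  by move=> x Ax; split; [exact: funS|apply: funK; rewrite inE].
by move=> y By; split; [exact: invS|apply: invK; rewrite inE].
Qed.

Section Grassmannian.
Variables (V : lmodType R) (I I' : Type).
Implicit Types P Q : Gr V I I'.

Definition adapted_basis P (B D : set V) : Prop :=
  [/\ lin_indep (B `|` D), forall x, B x -> ~ D x,
      span B = P :> set V & span (B `|` D) = [set: V] :> set V].

(** D lifts a basis of V / P by the chosen representatives. *)
Lemma exists_adapted_basis P : exists B D : set V,
  [/\ adapted_basis P B D, (B #= [set: I])%card & (D #= [set: I'])%card].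
Proof.
have [B [Bfree BP BI]] := gr_dim P; have [C [Cfree CT CI]] := gr_codim P.
pose D := repr @` C; exists B, D.
have Brepr x : B x -> quotproj P x = 0.
  move=> Bx; rewrite -[RHS](linear0 (quotproj P)); apply/eq_quotmod.
  by rewrite subr0 -BP; apply: span_gen.
have DC x : D x -> C (quotproj P x) by move=> [y Cy <-]; rewrite quotprojK.
have Dinj : {in D &, injective (quotproj P)}.
  by move=> x y /set_mem[x' _ <-] /set_mem[y' _ <-]; rewrite !quotprojK => ->.
have C0 : ~ C 0 by move=> /(lin_indep_neq0 Cfree).
have BD x : B x -> ~ D x by move=> /Brepr Bx /DC; rewrite Bx.
split=> //; last first.
  apply: card_eq_trans CI; apply: inj_card_eq => x y _ _ /(congr1 (quotproj P)).
  by rewrite !quotprojK.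
split=> //.
  move=> s c us sE s0.
  have cD v : v \in s -> D v -> c v = 0.
    move=> vs Dv; pose sD := [seq u <- s | u \in D].
    have sDP u : u \in sD -> D u /\ u \in s.
      by rewrite mem_filter => /andP[/set_mem].
    have -> : c v = c (repr (quotproj P v)).
      by have [y _ <-] := Dv; rewrite quotprojK.
    apply: (Cfree (map (quotproj P) sD) (c \o repr)).
    - rewrite map_inj_in_uniq ?filter_uniq// => x y /sDP[Dx _] /sDP[Dy _].
      by apply: Dinj; apply/mem_set.
    - by move=> _ /mapP[u /sDP[Du _] ->]; apply: DC.
    - transitivity (quotproj P (\sum_(v <- s) c v *: v)); last by rewrite s0 linear0.
      rewrite linear_sum big_map big_filter [RHS](bigID (mem D)) /=.
      rewrite [X in _ = _ + X]big1_seq ?addr0.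
        apply: eq_bigr => u /set_mem Du; rewrite linearZ /=.
        by have [y _ <-] := Du; rewrite quotprojK.
      move=> u /andP[nDu /sE[Bu|Du]]; last by rewrite (mem_set Du) in nDu.
      by rewrite linearZ /= Brepr// scaler0.
    - by apply: map_f; rewrite mem_filter (mem_set Dv).
  move=> v vs; have [Dv|nDv] := pselect (D v); first exact: cD.
  apply: (Bfree [seq u <- s | u \notin D] c); first exact: filter_uniq.
  - move=> u /=; rewrite mem_filter => /andP[/negP nDu /sE[//|Du]].
    by case: nDu; apply/mem_set.
  - rewrite big_filter -[RHS]s0 [RHS](bigID (mem D)) /= [X in _ = X + _]big1_seq ?add0r//.
    by move=> u /andP[/set_mem Du us']; rewrite cD// scale0r.
  - by rewrite mem_filter vs andbT; apply/negP => /set_mem.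
apply/seteqP; split=> // x _.
have : submodule_set (span C) (quotproj P x) by rewrite CT.
have -> : C = quotproj P @` D.
  by apply/seteqP; split=> [y Cy|_ [y /DC Cy <-]//]; exists (repr y); [exists y|rewrite quotprojK].
rewrite -image_span => -[d dD] /eq_quotmod; rewrite -BP => dx.
rewrite -[x](subKr d); apply: (@sub_diff _ _ (span (B `|` D))).
  by apply: (span_mono _ dD) => y; right.
by apply: (span_mono _ dx) => y; left.
Qed.

(** Adapted bases of P and Q match part by part, since both parts have
    prescribed cardinals. *)
Lemma GL_transitive P Q : exists g : GL V, gr_act g P = Q.
Proof.
have [B [D [[Efree BD BP ET] BI DI]]] := exists_adapted_basis P.
have [B' [D' [[E'free BD' BQ E'T] BI' DI']]] := exists_adapted_basis Q.
have [s [t [st ts]]] := card_eq_inverses 0 (card_eq_trans BI (card_esym BI')).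
have [s' [t' [st' ts']]] := card_eq_inverses 0 (card_eq_trans DI (card_esym DI')).
pose u x := if x \in B then s x else s' x.
pose w x := if x \in B' then t x else t' x.
have uB x : B x -> u x = s x by move=> Bx; rewrite /u mem_set.
have uD x : D x -> u x = s' x.
  by move=> Dx; rewrite /u memNset// => /BD.
have wB x : B' x -> w x = t x by move=> Bx; rewrite /w mem_set.
have wD x : D' x -> w x = t' x.
  by move=> Dx; rewrite /w memNset// => /BD'.
have [||g gE] := @GL_of_bases _ (B `|` D) (B' `|` D') u w Efree ET E'free E'T.
- move=> e [Be|De].
    by have [? ?] := st e Be; rewrite uB// wB//; split=> //; left.
  by have [? ?] := st' e De; rewrite uD// wD//; split=> //; right.
- move=> e [Be|De].
    by have [? ?] := ts e Be; rewrite wB// uB//; split=> //; left.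
  by have [? ?] := ts' e De; rewrite wD// uD//; split=> //; right.
exists g; apply: Gr_inj; rewrite /= -BP -BQ image_span.
congr (submodule_set (span _)); apply/seteqP; split=> [_ [e Be <-]|e B'e].
  by rewrite gE ?uB//; [have [] := st e Be|left].
have [Bt te] := ts e B'e.
by exists (t e); rewrite // gE ?uB//; left.
Qed.

End Grassmannian.
End Bases.

(** * Neighbours *)

Section GrassmannianAction.
Variables (F : nzRingType) (V : lmodType F) (I I' : Type).
Implicit Types (P Q : Gr V I I') (A W : submodule V) (g h : GL V).

Definition image_sub g W : submodule V :=
  Submodule (image_is_submodule g (submodule_closed W)).

Lemma image_sub_mem g W x : image_sub g W (g x) <-> W x.
Proof.
split=> [[y Wy /(bij_inj (gl_bij g)) <-]//|Wx].
by exists x.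
Qed.

Lemma image_sub_adjoin g W v : image_sub g (adjoin W v) = adjoin (image_sub g W) (g v).
Proof.
apply: submodule_ext => y; split=> [[x /adjoinP[w [a [Ww ->]]] <-]|].
  by apply/adjoinP; exists (g w), a; split; [exists w|rewrite linearD linearZ].
move=> /adjoinP[_ [a [[w Ww <-] ->]]]; exists (w + a *: v).
  by apply/adjoinP; exists w, a.
by rewrite linearD linearZ.
Qed.

Lemma gr_space_act g P : gr_act g P = image_sub g P :> submodule V.
Proof. exact: submodule_inj. Qed.

Lemma gr_eq P Q : P = Q :> submodule V -> P = Q.
Proof. by move=> e; apply: Gr_inj; rewrite e. Qed.

Lemma gr_act_inj g : injective (fun P => gr_act g P).
Proof.
move=> P Q /= /(congr1 (@gr_space _ _ _ _)); rewrite !gr_space_act => e.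
by apply: gr_eq; apply: submodule_ext => x; split=> /(image_sub_mem g);
  [rewrite e|rewrite -e] => /image_sub_mem.
Qed.

Fact GL_mul_bij g h : bijective (gl_fun g \o gl_fun h).
Proof. exact: bij_comp (gl_bij g) (gl_bij h). Qed.

Definition GL_mul g h : GL V := @MkGL _ _ (g \o h) (GL_mul_bij g h).

Definition GL_one : GL V := @MkGL _ _ idfun (Bijective (fun=> erefl) (fun=> erefl)).

Lemma image_sub_mul g h W : image_sub (GL_mul g h) W = image_sub g (image_sub h W).
Proof.
by apply: submodule_ext => y; split=> [[x Wx <-]|[_ [x Wx <-] <-]];
  [exists (h x) => //; exists x|exists x].
Qed.

Lemma gr_act_mul g h P : gr_act (GL_mul g h) P = gr_act g (gr_act h P).
Proof. by apply: gr_eq; rewrite !gr_space_act image_sub_mul. Qed.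

Lemma image_sub_fix g W : (forall w, W w -> g w = w) -> image_sub g W = W.
Proof.
move=> gW; apply: submodule_ext => x; split=> [[w Ww <-]|Wx]; first by rewrite gW.
by exists x; rewrite ?gW.
Qed.

Lemma gr_act_one P : gr_act GL_one P = P.
Proof. by apply: gr_eq; rewrite gr_space_act; apply: image_sub_fix. Qed.

(** Adjacency in terms of vectors. Only q is required to lie outside P; that p
    lies outside Q follows by exchange. *)
Definition neighbours P Q : Prop := exists A p q,
  [/\ ~ A p, ~ P q, P = adjoin A p :> submodule V & Q = adjoin A q :> submodule V].

Lemma neighbours_act g P Q : neighbours P Q -> neighbours (gr_act g P) (gr_act g Q).
Proof.
move=> [A [p [q [nAp nPq PE QE]]]]; exists (image_sub g A), (g p), (g q).
by split; rewrite ?gr_space_act ?image_sub_mem// ?PE ?QE image_sub_adjoin.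
Qed.

(** A basis of W / A has one element, the class of p. *)
Lemma line_of_dim1 A W : A `<=` W -> has_dim (quotproj A @` W) unit ->
  exists p, ~ A p /\ W = adjoin A p.
Proof.
move=> AW [B [Bfree Bspan B1]].
have [y By] : B !=set0.
  apply/set0P/negP => /eqP B0; move: B1; rewrite B0 card_eq_sym card_eq0.
  by move=> /eqP/seteqP[/(_ tt Logic.I)].
have BE : B = [set y].
  apply/seteqP; split=> [z Bz|_ ->//].
  have /card_eqPle[/pcard_injP[f finj] _] := B1.
  by apply: finj; rewrite ?inE//; case: (f z); case: (f y).
have : submodule_set (span B) y by apply: sub_gen_smallest.
rewrite Bspan => -[p Wp pE].
have nAp : ~ A p.
  move=> Ap; apply: (lin_indep_neq0 Bfree By).
  by rewrite -pE -[RHS](linear0 (quotproj A)); apply/eq_quotmod; rewrite subr0.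
exists p; split=> //; apply: submodule_inj; apply/seteqP; split; last first.
  exact: (adjoin_sub AW).
move=> x Wx; have : (quotproj A @` W) (quotproj A x) by exists x.
rewrite -Bspan span_combs BE => -[s [c [_ sy]]].
have -> : \sum_(v <- s) c v *: v = quotproj A (\sum_(v <- s) c v *: p).
  by rewrite linear_sum; apply: eq_big_seq => v /sy ->; rewrite linearZ /= pE.
by rewrite -scaler_suml => /eq_quotmod xp; exists (\sum_(v <- s) c v).
Qed.

Lemma adjacent_neighbours P Q : adjacent P Q -> neighbours P Q.
Proof.
move=> [dP dQ]; set A := submoduleI P Q in dP dQ.
have [p [nAp PE]] := line_of_dim1 (A := A) (@subIsetl _ P Q) dP.
have [q [nAq QE]] := line_of_dim1 (A := A) (@subIsetr _ P Q) dQ.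
exists A, p, q; split=> // Pq; apply: nAq; split=> //.
by rewrite QE; apply: adjoin_mem.
Qed.

End GrassmannianAction.

Section NeighbourTransitivity.
Variables (F : unitRingType) (V : lmodType F) (I I' : Type).
Hypothesis divF : forall a : F, a != 0 -> a \is a GRing.unit.
Hypothesis infF : infinite_set [set: F].
Implicit Types (P Q : Gr V I I').

(** Move P to Q, then the common hyperplane to that of Q and Q' inside Q, then
    the remaining direction while fixing Q pointwise. *)
Lemma GL_transitive_neighbours P P' Q Q' : neighbours P P' -> neighbours Q Q' ->
  exists g : GL V, gr_act g P = Q /\ gr_act g P' = Q'.
Proof.
move=> nPP' [A2 [p2 [q2 [nA2p2 nQq2 QE Q'E]]]].
have [g0 g0P] := GL_transitive P Q.
have := neighbours_act g0 nPP'; rewrite g0P => -[A1 [p1 [q1 [nA1p1 nQq1 QE1 P'E]]]].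
have [g1 [_ g1Q g1A]] := shear_replaces_hyperplane divF QE1 nA1p1 QE nA2p2.
have {}g1Q : image_sub g1 Q = Q by apply: submodule_inj.
have {}g1A : image_sub g1 A1 = A2 by apply: submodule_inj.
have ng1q1 : ~ Q (g1 q1) by rewrite -g1Q image_sub_mem.
have [g2 [_ g2Q g2q1]] := shear_replaces_vector divF infF ng1q1 nQq2.
exists (GL_mul (GL_mul g2 g1) g0); rewrite !gr_act_mul; split; apply: gr_eq.
  by rewrite g0P !gr_space_act g1Q; apply: image_sub_fix.
rewrite 2!gr_space_act P'E !image_sub_adjoin g1A g2q1 image_sub_fix -?Q'E//.
by move=> a A2a; apply: g2Q; rewrite QE; apply: adjoin_base.
Qed.

End NeighbourTransitivity.

(** * Formal combinations *)

Section FormalSums.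
Variables (A : nzRingType) (T : choiceType).
Implicit Types x y : {freeg T / A}.

Lemma freeg_ext x y : (forall t, coeff t x = coeff t y) -> x = y.
Proof. by move=> e; apply/eqP/freeg_eqP. Qed.

Lemma freegU_scale (c : A) (t : T) : << c *g t >> = c *: << t >>.
Proof. by apply: freeg_ext => u; rewrite coeffZ !coeffU mul1r. Qed.

Lemma freeg_expand x : x = \sum_(t <- dom x) coeff t x *: << t >>.
Proof. by rewrite -[LHS]freeg_sumE; apply: eq_bigr => t _; apply: freegU_scale. Qed.

Lemma coeff_expand x t : \sum_(u <- dom x) coeff u x * (u == t)%:R = coeff t x.
Proof.
rewrite -[in RHS](freeg_sumE x) (big_morph _ (coeffD _) (coeff0 _ _)).
by apply: eq_bigr => u _; rewrite coeffU.
Qed.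

Lemma freeg_neq0_dom x : x <> 0 -> exists t, t \in dom x.
Proof.
move=> /eqP x0; move: x0; rewrite -dom_eq0.
by case: (dom x) => // t s _; exists t; apply: mem_head.
Qed.

(** The linear form with value chi t on the basis vector t. *)
Definition weighted_sum (chi : T -> A) x : A^o := \sum_(t <- dom x) coeff t x * chi t.

Lemma weighted_sum_widen chi (s : seq T) x : uniq s -> {subset dom x <= s} ->
  weighted_sum chi x = \sum_(t <- s) coeff t x * chi t.
Proof.
move=> us xs; rewrite [RHS](bigID (mem (dom x))) /= [X in _ + X]big1 ?addr0.
  rewrite -big_filter; apply: perm_big; apply: uniq_perm (uniq_dom x) (filter_uniq _ us) _.
  by move=> t; rewrite mem_filter /=; case: (boolP (t \in dom x)) => // /xs ->.
by move=> t /coeff_outdom ->; rewrite mul0r.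
Qed.

Fact weighted_sum_linear chi : linear (weighted_sum chi).
Proof.
move=> a x y; pose s := undup (dom x ++ dom y ++ dom (a *: x + y)).
have us : uniq s := undup_uniq _.
have in_s t : t \in s = [|| t \in dom x, t \in dom y | t \in dom (a *: x + y)].
  by rewrite mem_undup !mem_cat.
rewrite (weighted_sum_widen (x := x) chi us) => [|t]; last by rewrite in_s => ->.
rewrite (weighted_sum_widen (x := y) chi us) => [|t]; last by rewrite in_s => ->; rewrite orbT.
rewrite (weighted_sum_widen chi us) => [|t]; last by rewrite in_s => ->; rewrite !orbT.
rewrite scaler_sumr -big_split; apply: eq_bigr => t _ /=.
by rewrite coeffD coeffZ mulrDl -mulrA.
Qed.

HB.instance Definition _ chi :=
  GRing.isLinear.Build A {freeg T / A} A^o *:%R (weighted_sum chi) (weighted_sum_linear chi).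

Lemma weighted_sumU chi (t : T) : weighted_sum chi << t >> = chi t.
Proof. by rewrite /weighted_sum domU1 big_seq1 coeffU eqxx mulr1 mul1r. Qed.

Definition total : {freeg T / A} -> A^o := weighted_sum (fun=> 1).

HB.instance Definition _ :=
  GRing.isLinear.Build A {freeg T / A} A^o *:%R total (weighted_sum_linear (fun=> 1)).

Lemma totalE x : total x = \sum_(t <- dom x) coeff t x.
Proof. by apply: eq_bigr => t _; rewrite mulr1. Qed.

Lemma totalU (t : T) : total << t >> = 1.
Proof. exact: weighted_sumU. Qed.

Lemma zero_sumP x : zero_sum A T x <-> total x = 0.
Proof. by rewrite totalE. Qed.

Lemma zero_sum_is_submodule : is_submodule (zero_sum A T).
Proof.
apply/is_submoduleP; split; first by apply/zero_sumP; rewrite linear0.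
move=> a u v /zero_sumP u0 /zero_sumP v0; apply/zero_sumP.
by rewrite linearP /= u0 v0 scaler0 addr0.
Qed.

(** As the coefficients add up to zero, subtracting a base point changes
    nothing. *)
Lemma zero_sum_expand x (t0 : T) : zero_sum A T x ->
  x = \sum_(t <- dom x) coeff t x *: (<< t >> - << t0 >>).
Proof.
move=> x0; under eq_bigr do rewrite scalerBr.
rewrite sumrB -freeg_expand -scaler_suml.
have -> : \sum_(t <- dom x) coeff t x = 0 by exact: x0.
by rewrite scale0r subr0.
Qed.

End FormalSums.

Section GrassmannianModule.
Variables (F : nzRingType) (V : lmodType F) (I I' : Type) (A : nzRingType).
Local Notation Gr := (Gr V I I').
Local Notation FG := {freeg Gr / A}.
Implicit Types (P Q : Gr) (g : GL V) (x y : FG).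

Lemma gr_act_surj g Q : exists P, gr_act g P = Q.
Proof.
have [h gK hK] := gl_bij g.
have [h' h'E] := exists_linear (can2_linear gK hK).
have h'bij : bijective h'.
  by exists g => v; rewrite h'E ?gK ?hK.
exists (gr_act (MkGL h'bij) Q); apply: gr_eq; rewrite !gr_space_act.
apply: submodule_ext => v; split=> [[_ [u Qu <-] <-]|Qv]; first by rewrite /= h'E hK.
by exists (h v); [exists v; rewrite //= h'E|rewrite hK].
Qed.

Lemma free_actU g P : free_act A g << P >> = << gr_act g P >>.
Proof. by rewrite /free_act liftU scale1r. Qed.

Lemma coeff_free_act g P x : coeff (gr_act g P) (free_act A g x) = coeff P x.
Proof.
rewrite -[in LHS](freeg_sumE x).
have -> : free_act A g (\sum_(Q <- dom x) << coeff Q x *g Q >>) =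
          \sum_(Q <- dom x) << coeff Q x *g gr_act g Q >>.
  have act0 : free_act A g (0 : FG) = 0.
    by have := free_actB g (0 : FG) 0; rewrite !subrr.
  have actD (y z : FG) : free_act A g (y + z) = free_act A g y + free_act A g z.
    by rewrite -{1}[z]opprK free_actB -[- z]sub0r free_actB act0 sub0r opprK.
  elim: (dom x) => [|Q s IHs]; first by rewrite !big_nil.
  by rewrite !big_cons actD IHs /free_act liftU -freegU_scale.
rewrite (big_morph _ (coeffD _) (coeff0 _ _)).
under eq_bigr do rewrite coeffU (inj_eq (@gr_act_inj _ _ _ _ g)).
exact: coeff_expand.
Qed.

Fact free_act_linear g : linear (free_act A g : FG -> FG).
Proof.
move=> a x y; apply: freeg_ext => Q; have [P <-] := gr_act_surj g Q.
by rewrite coeffD coeffZ !coeff_free_act coeffD coeffZ.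
Qed.

HB.instance Definition _ g :=
  GRing.isLinear.Build A FG FG *:%R (@free_act _ _ I I' A g) (free_act_linear g).

Lemma free_act_expand g x :
  free_act A g x = \sum_(P <- dom x) coeff P x *: << gr_act g P >>.
Proof.
rewrite [in LHS](freeg_expand x) linear_sum; apply: eq_bigr => P _.
by rewrite linearZ /= free_actU.
Qed.

Lemma dom_free_act g x Q : Q \in dom (free_act A g x) ->
  exists2 P, P \in dom x & gr_act g P = Q.
Proof.
have [P <-] := gr_act_surj g Q.
by rewrite mem_dom coeff_free_act -mem_dom; exists P.
Qed.

Lemma total_free_act g x : total (free_act A g x) = total x.
Proof.
rewrite free_act_expand [in RHS](freeg_expand x) !linear_sum /=.
by apply: eq_bigr => P _; rewrite !linearZ /= !totalU.
Qed.

(** ** Isolating a class of the support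

    kappa sorts the members of Y into classes, and k0 is the class to be kept.
    For any other class that meets the support of x there must be elements of
    the group which fix this class pointwise, preserve all classes, and
    displace any given finite part of the class k0 from itself. *)
Section ClassIsolation.
Variables (T : Type) (kappa : Gr -> T) (Y : set Gr) (k0 : T).
Variables (N : set FG) (x : FG).
Hypothesis Nrep : subrep (free_act A) N.
Hypothesis separable : forall P, P \in dom x -> kappa P <> k0 -> forall s : seq Gr,
  exists g, [/\ forall Q, Y Q -> Y (gr_act g Q) /\ kappa (gr_act g Q) = kappa Q,
    forall Q, Y Q -> kappa Q = kappa P -> gr_act g Q = Q &
    forall Q Q', Q \in s -> Q' \in s -> Y Q -> Y Q' -> kappa Q = k0 -> kappa Q' = k0 ->
      gr_act g Q <> Q'].

(** Replace y by g y - y once for each class to be destroyed. Fixed members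
    cancel, no new class appears, and on the class k0 the supports of g y and
    y are disjoint, so that this part of g y - y stays nonzero. *)
Lemma isolate_class : N x -> (forall P, P \in dom x -> Y P) ->
  (exists2 P, P \in dom x & kappa P = k0) ->
  exists y, [/\ N y, y <> 0 & forall Q, Q \in dom y -> Y Q /\ kappa Q = k0].
Proof.
move=> Nx xY x0.
suff main (l : seq Gr) : {subset l <= dom x} -> forall y, N y ->
    (forall Q, Q \in dom y -> Y Q /\ (kappa Q = k0 \/ exists2 P, P \in l & kappa Q = kappa P)) ->
    (exists2 P, P \in dom y & kappa P = k0) ->
    exists y, [/\ N y, y <> 0 & forall Q, Q \in dom y -> Y Q /\ kappa Q = k0].
  apply: (main (dom x) _ x) => // Q Qx; split; first exact: xY.
  by right; exists Q.
elim: l => [|P l IHl] lx y Ny yP [P0 P0y P0k].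
  exists y; split=> // [y0|Q /yP[YQ [//|[]//]]].
  by move: P0y; rewrite y0 dom0.
have [PE|Pk] := pselect (kappa P = k0).
  apply: (IHl _ y) => [Q Ql|//|Q /yP[YQ [|[P']]]|]; [|by split; [|left]| |by exists P0].
    by apply: lx; rewrite inE Ql orbT.
  rewrite inE => /predU1P[->|P'l] QP'; split=> //; first by left; rewrite QP'.
  by right; exists P'.
have [g [gY gfix gmove]] := separable (lx _ (mem_head _ _)) Pk (dom y).
have [/is_submoduleP[_ Nlin] Nact] := Nrep.
pose z : FG := (-1) *: y + free_act A g y.
have zE Q : coeff Q z = coeff Q (free_act A g y) - coeff Q y.
  by rewrite coeffD coeffZ mulN1r addrC.
have zdom Q : Q \in dom z -> (Q \in dom y) \/ (exists2 Q', Q' \in dom y & gr_act g Q' = Q).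
  rewrite mem_dom zE; have [Qy|nQy] := boolP (Q \in dom y); first by left.
  rewrite (coeff_outdom nQy) subr0 -mem_dom => /dom_free_act; first by right.
apply: (IHl _ z).
- by move=> Q Ql; apply: lx; rewrite inE Ql orbT.
- by apply: Nlin => //; apply: Nact.
- move=> Q Qz.
  have [YQ kQ] : Y Q /\ (kappa Q = k0 \/ exists2 P', P' \in P :: l & kappa Q = kappa P').
    have [/yP//|[Q' /yP[YQ' kQ'] <-]] := zdom Q Qz.
    by have [YgQ' ->] := gY _ YQ'.
  split=> //; case: kQ => [|[P' + kQ]]; first by left.
  rewrite inE => /predU1P[P'P|P'l]; last by right; exists P'.
  have gQ : gr_act g Q = Q by apply: gfix; rewrite // kQ P'P.
  by move: Qz; rewrite mem_dom zE -{1}gQ coeff_free_act subrr eqxx.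
- exists P0 => //; rewrite mem_dom zE.
  suff -> : coeff P0 (free_act A g y) = 0 by rewrite sub0r oppr_eq0 -mem_dom.
  apply: coeff_outdom; apply/negP => /dom_free_act[Q Qy gQ].
  have [YQ _] := yP Q Qy; have [YP0 _] := yP P0 P0y.
  apply: (gmove Q P0 Qy P0y YQ YP0 _ P0k gQ).
  by rewrite -P0k -gQ; have [_ ->] := gY _ YQ.
Qed.

End ClassIsolation.
End GrassmannianModule.

(** * Reduction to a pencil *)

Lemma exists_maximal (T : eqType) (r : T -> T -> Prop) (s : seq T) (x : T) :
  (forall a b c, r a b -> r b c -> r a c) -> x \in s ->
  exists2 m, m \in s & forall y, y \in s -> r m y -> r y m.
Proof.
move=> rtrans; elim: s x => [//|a [|b s] IHs] x _.
  by exists a => [|y]; rewrite inE// => /eqP ->.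
have [m ms mmax] := IHs b (mem_head _ _).
have [rma|nrma] := pselect (r m a).
  exists a => [|y]; first exact: mem_head.
  rewrite inE => /predU1P[->//|ys ray].
  exact: rtrans (mmax _ ys (rtrans _ _ _ rma ray)) rma.
exists m => [|y]; first by rewrite inE ms orbT.
by rewrite inE => /predU1P[->//|]; apply: mmax.
Qed.

Section ReductionToPencil.
Variables (F : unitRingType) (V : lmodType F) (I I' : Type) (K : nzRingType).
Hypothesis divF : forall a : F, a != 0 -> a \is a GRing.unit.
Hypothesis infF : infinite_set [set: F].
Local Notation Gr := (Gr V I I').
Implicit Types (P Q : Gr) (A B W : submodule V).

Lemma has_dim_nonzero (U : lmodType F) (S : set U) (J : Type) :
  inhabited J -> has_dim S J -> exists2 u, S u & u <> 0.
Proof.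
move=> [j] [E [Efree <- EJ]].
have [y Ey] : E !=set0.
  apply/set0P/negP => /eqP E0; move: EJ; rewrite E0 card_eq_sym card_eq0.
  by move=> /eqP/seteqP[/(_ j Logic.I)].
by exists y; [apply: sub_gen_smallest|apply: lin_indep_neq0 Ey].
Qed.

Lemma gr_proper P : inhabited I' -> exists u, ~ P u.
Proof.
move=> /has_dim_nonzero/(_ (gr_codim P))[u _ u0]; exists (repr u) => Pu.
apply: u0; rewrite -[u]quotprojK -[RHS](linear0 (quotproj P)).
by apply/eq_quotmod; rewrite subr0.
Qed.

Lemma gr_nonzero P : inhabited I -> exists2 p, P p & p <> 0.
Proof. by move=> /has_dim_nonzero/(_ (gr_dim P)). Qed.

Section Transvection.
Variables (phi : {linear V -> F^o}) (w : V) (g : GL V).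
Hypothesis phiw : phi w = 0.
Hypothesis gE : forall x, g x = x + phi x *: w.

Lemma transvection_fix_kernel P : (forall x, P x -> phi x = 0) -> gr_act g P = P.
Proof.
move=> phiP; apply: gr_eq; rewrite gr_space_act; apply: image_sub_fix => x Px.
by rewrite gE phiP// scale0r addr0.
Qed.

Lemma transvectionK x : g (x - phi x *: w) = x.
Proof. by rewrite gE linearB [phi (_ *: w)]linearZ_LR /= phiw scaler0 subr0 subrK. Qed.

Lemma transvection_fix_center P : P w -> gr_act g P = P.
Proof.
move=> Pw; apply: gr_eq; rewrite gr_space_act; apply: submodule_ext => x.
split=> [[p Pp <-]|Px]; first by rewrite gE; apply/sub_add/sub_scale.
by exists (x - phi x *: w); [apply/sub_diff/sub_scale|apply: transvectionK].
Qed.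

End Transvection.

(** If Q contains q with phi q nonzero, its images under x + phi(x) t w contain
    the distinct points q + phi(q) t w of an affine line of direction w; a
    subspace Q' without w contains at most one of them, so each pair Q, Q'
    excludes at most one t. *)
Lemma exists_displacing_transvection (phi : {linear V -> F^o}) w (C : set Gr) (s : seq Gr) :
  phi w = 0 -> (forall Q, C Q -> ~ Q w /\ exists2 q, Q q & phi q != 0) ->
  exists t (g : GL V), (forall x, g x = x + phi x *: (t *: w)) /\
    forall Q Q', Q \in s -> Q' \in s -> C Q -> C Q' -> gr_act g Q <> Q'.
Proof.
move=> phiw CP.
pose good (QQ : Gr * Gr) t := forall g : GL V, (forall x, g x = x + phi x *: (t *: w)) ->
  C QQ.1 -> C QQ.2 -> gr_act g QQ.1 <> QQ.2.
have [QQ _|t tP] := @exists_avoiding F infF _ [seq (Q, Q') | Q <- s, Q' <- s] good.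
  have [[b bad]|allgood] := pselect (exists b, ~ good QQ b); last first.
    by exists 0 => t _; apply: contrapT => nt; apply: allgood; exists t.
  exists b => t /eqP tb; apply: contrapT => tbad; apply: tb.
  have meet u : ~ good QQ u -> [/\ C QQ.1, C QQ.2 &
      forall q, QQ.1 q -> QQ.2 (q + (phi q * u) *: w)].
    move=> nu; apply: contrapT => H; apply: nu => g gE C1 C2 gQ; apply: H; split=> // q Qq.
    by rewrite -gQ gr_space_act -scalerA -gE image_sub_mem.
  have [C1 C2 mt] := meet t tbad; have [_ _ mb] := meet b bad.
  have [_ [q Qq phiq]] := CP _ C1; have [nQw _] := CP _ C2.
  have e := affine_line_meets divF nQw (mt q Qq) (mb q Qq).
  by rewrite -[t]mul1r -[b]mul1r -(mulfVl divF phiq) -!mulrA e.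
have [|g gE] := @exists_transvection _ _ divF phi (t *: w).
  by rewrite linearZ_LR /= phiw scaler0.
exists t, g; split=> // Q Q' Qs Q's CQ CQ'.
by apply: (tP (Q, Q') _ g) => //; apply: allpairs_f.
Qed.

Variable N : set {freeg Gr / K}.
Hypothesis Nrep : subrep (free_act K) N.

(** The classes are the P + Fv. Keeping a maximal one, P0 + Fv, any other class
    P + Fv is contained in the kernel of some phi not vanishing on P0 + Fv;
    the transvections of axis ker phi and center v fix the class P + Fv pointwise. *)
Lemma reduce_to_hyperplanes x : inhabited I' -> N x -> x <> 0 ->
  exists v B y, [/\ N y, y <> 0 & forall Q, Q \in dom y -> ~ Q v /\ adjoin Q v = B].
Proof.
move=> I'0 Nx /freeg_neq0_dom[P1 P1x].
have [v vP] := @exists_generic_vector _ _ divF infF Gr (dom x) (@gr_space _ _ I I')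
  (fun P _ => gr_proper P I'0).
have [P0 P0x P0max] := @exists_maximal Gr
  (fun P Q => adjoin P v `<=` adjoin Q v) (dom x) P1
  (fun a b c ab bc => subset_trans ab bc) P1x.
have [||||y [Ny y0 yP]] := @isolate_class _ _ _ _ K (submodule V)
    (fun P => adjoin P v) [set Q : Gr | ~ Q v] (adjoin P0 v) N x Nrep.
- move=> P Px nPP0 s.
  have [b P0b nPb] : exists2 b, adjoin P0 v b & ~ adjoin P v b.
    apply: contrapT => nb.
    have P0P : adjoin P0 v `<=` adjoin P v.
      by move=> b P0b; apply: contrapT => nPb; apply: nb; exists b.
    by apply: nPP0; apply/submodule_inj/seteqP; split=> //; apply: P0max.
  have [phi [phiP phib]] := exists_functional divF nPb.
  have phiv : phi v = 0 by apply/phiP/adjoin_mem.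
  have [Q [nQv QE]|t [g [gE gmove]]] := @exists_displacing_transvection phi v
      [set Q : Gr | ~ Q v /\ adjoin Q v = adjoin P0 v] s phiv.
    split=> //; move: P0b; rewrite -QE => /adjoinP[q [a [Qq bE]]]; exists q => //.
    move: phib; rewrite bE linearD linearZ_LR /= phiv scaler0 addr0 => ->.
    exact: oner_neq0.
  have phitv : phi (t *: v) = 0 by rewrite linearZ_LR /= phiv scaler0.
  have gv : g v = v by rewrite gE phiv scale0r addr0.
  exists g; split=> [Q nQv|Q _ QE|Q Q' Qs Q's YQ YQ' kQ kQ'].
  + split; first by rewrite /mkset gr_space_act -gv image_sub_mem.
    rewrite gr_space_act; apply/submodule_inj/seteqP; split; apply: adjoin_sub.
    * move=> _ [q Qq <-]; rewrite gE scalerA; apply: (@sub_add _ _ (adjoin Q v)).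
        exact: adjoin_base.
      exact/sub_scale/adjoin_mem.
    * exact: adjoin_mem.
    * move=> q Qq; rewrite -[q](addrK (phi q *: (t *: v))) -gE scalerA.
      apply: (@sub_diff _ _ (adjoin (image_sub g Q) v)).
        by apply: adjoin_base; apply/image_sub_mem.
      exact/sub_scale/adjoin_mem.
    * exact: adjoin_mem.
  + apply: (transvection_fix_kernel gE) => q Qq; apply: phiP.
    by rewrite -QE; apply: adjoin_base.
  + exact: gmove.
- exact: Nx.
- exact: vP.
- by exists P0.
- by exists v, (adjoin P0 v), y; split.
Qed.

(** Dual to [reduce_to_hyperplanes]: the classes are the traces on the kernel
    of one phi, and a minimal one is kept. Any other trace contains some w
    outside the minimal one; transvections of axis ker phi and center w fix all
    subspaces containing w. As w lies in B, supports remain below B. *)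
Lemma reduce_to_kernel_trace x B : inhabited I -> N x -> x <> 0 ->
  (forall Q, Q \in dom x -> Q `<=` B) ->
  exists (phi : {linear V -> F^o}) P0 y, [/\ P0 \in dom x, N y, y <> 0 &
    forall Q, (Q = P0) \/ Q \in dom y -> [/\ Q `<=` B, exists2 q, Q q & phi q != 0 &
      submoduleI Q (kernel phi) = submoduleI P0 (kernel phi)]].
Proof.
move=> I0 Nx /freeg_neq0_dom[P1 P1x] xB.
have nonzero P : exists p, P p /\ p <> 0 by have [p] := gr_nonzero P I0; exists p.
have [f fP] := choice nonzero.
have zero_sub : is_submodule [set (0 : V)].
  by apply/is_submoduleP; split=> // a u v /= -> ->; rewrite scaler0 addr0.
have [|phi [_ phiP]] := @exists_generic_functional _ _ divF infF (Submodule zero_sub)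
    (map f (dom x)).
  by move=> _ /mapP[P _ ->]; have [_] := fP P.
pose kappa P := submoduleI P (kernel phi).
have kappaE P z : submodule_set (kappa P) z <-> P z /\ phi z = 0 by [].
have phi_dom P : P \in dom x -> exists2 q, P q & phi q != 0.
  by move=> Px; exists (f P); [have [] := fP P|apply/phiP/map_f].
have [P0 P0x P0min] := @exists_maximal Gr (fun P Q => kappa Q `<=` kappa P) (dom x) P1
  (fun a b c ab bc => subset_trans bc ab) P1x.
have [||||y [Ny y0 yP]] := @isolate_class _ _ _ _ K (submodule V) kappa
    [set Q : Gr | Q `<=` B /\ exists2 q, Q q & phi q != 0] (kappa P0) N x Nrep.
- move=> P Px nPP0 s.
  have [w [Pw phiw] nP0w] : exists2 w, submodule_set (kappa P) w & ~ submodule_set (kappa P0) w.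
    apply: contrapT => nw.
    have PP0 : kappa P `<=` kappa P0.
      by move=> w Pw; apply: contrapT => nP0w; apply: nw; exists w.
    by apply: nPP0; apply/submodule_inj/seteqP; split=> //; apply: P0min.
  have [Q [[QB Qphi] QE]|t [g [gE gmove]]] := @exists_displacing_transvection phi w
      [set Q : Gr | (Q `<=` B /\ exists2 q, Q q & phi q != 0) /\ kappa Q = kappa P0] s phiw.
    by split=> // Qw; apply: nP0w; rewrite -QE.
  have phitw : phi (t *: w) = 0 by rewrite linearZ_LR /= phiw scaler0.
  have phig z : phi (g z) = phi z.
    by rewrite gE linearD [phi (_ *: _)]linearZ_LR /= phitw scaler0 addr0.
  exists g; split=> [Q [QB [q Qq phiq]]|Q _ QE|Q Q' Qs Q's YQ YQ' kQ kQ'].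
  + split.
      split; last by exists (g q); [rewrite gr_space_act image_sub_mem|rewrite phig].
      rewrite gr_space_act => _ [z Qz <-]; rewrite gE.
      apply: (@sub_add _ _ B); first exact: QB.
      by apply/sub_scale/sub_scale; apply: xB Px _ Pw.
    apply/submodule_inj/seteqP; split=> z; rewrite !kappaE gr_space_act.
      by move=> [[u Qu <-]]; rewrite phig => u0; rewrite gE u0 scale0r addr0.
    move=> [Qz z0]; split=> //; exists z => //.
    by rewrite gE z0 scale0r addr0.
  + apply: (transvection_fix_center phitw gE); apply: sub_scale.
    by have : submodule_set (kappa Q) w by [rewrite QE]; case.
  + exact: gmove.
- exact: Nx.
- by move=> P Px; split; [apply: xB|apply: phi_dom].
- by exists P0.
- exists phi, P0, y; split=> // Q [->|/yP[[QB Qphi] QE]//].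
  by split=> //; [apply: xB|apply: phi_dom].
Qed.

(** The two sweeps in succession. Since P0 comes from the support left by the
    first, P0 + Fv is the space B, and the pencil is made of the A + Fq with q
    in B outside A. *)
Lemma reduce_to_pencil x : inhabited I -> inhabited I' -> N x -> x <> 0 ->
  exists A p v P0 y, [/\ P0 = adjoin A p :> submodule V, ~ A p, ~ P0 v, N y /\ y <> 0 &
    forall Q, Q \in dom y ->
      exists q, [/\ Q = adjoin A q :> submodule V, ~ A q & adjoin P0 v q]].
Proof.
move=> I0 I'0 Nx x0.
have [v [B [x' [Nx' x'0 x'B]]]] := reduce_to_hyperplanes I'0 Nx x0.
have [|phi [P0 [y [P0x' Ny y0 yP]]]] := @reduce_to_kernel_trace x' B I0 Nx' x'0.
  by move=> Q /x'B[_ <-]; apply: adjoin_base.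
set A := submoduleI P0 (kernel phi) in yP.
have QA Q : Q = P0 \/ Q \in dom y -> exists q, [/\ Q q, Q = adjoin A q :> submodule V & ~ A q].
  move=> /yP[QB [q Qq phiq] <-].
  by have [QE nAq] := adjoin_kernel_trace divF Qq phiq; exists q; split.
have [p [_ P0E nAp]] := QA P0 (or_introl erefl).
have [nP0v BE] := x'B _ P0x'.
exists A, p, v, P0, y; split=> // Q Qy.
have [q [Qq QE nAq]] := QA Q (or_intror Qy); exists q; split=> //.
by rewrite BE; have [QB _ _] := yP Q (or_intror Qy); apply: QB.
Qed.

End ReductionToPencil.

(** * Finite differences *)

Section FiniteDifferences.
Variables (F : unitRingType) (K : fieldType) (M : lmodType K).
Implicit Types (f : F -> M) (hs : seq F).

Fixpoint diffs hs f : F -> M :=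
  if hs is h :: hs' then diffs hs' (fun b => f (b + h) - f b) else f.

Lemma eq_diffs hs f g : f =1 g -> diffs hs f =1 diffs hs g.
Proof. by elim: hs f g => [//|h hs IHhs] f g fg; apply: IHhs => b; rewrite !fg. Qed.

Lemma diffs_shift hs f w b : diffs hs (fun b => f (b + w)) b = diffs hs f (b + w).
Proof.
elim: hs f => [//|h hs IHhs] f /=.
by rewrite -IHhs; apply: eq_diffs => c; rewrite addrAC.
Qed.

Lemma diffs_sum hs (T : Type) (s : seq T) (c : T -> K) (f : T -> F -> M) b :
  diffs hs (fun b => \sum_(i <- s) c i *: f i b) b = \sum_(i <- s) c i *: diffs hs (f i) b.
Proof.
elim: hs f => [//|h hs IHhs] f /=.
rewrite -IHhs; apply: eq_diffs => a; rewrite -sumrB.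
by apply: eq_bigr => i _; rewrite scalerBr.
Qed.

Lemma diffs_sub hs f g b : diffs hs (fun b => f b - g b) b = diffs hs f b - diffs hs g b.
Proof.
elim: hs f g => [//|h hs IHhs] f g /=.
by rewrite -IHhs; apply: eq_diffs => a; rewrite !opprB (AC (2*2) ((1*4)*(3*2))).
Qed.

Lemma diffs_cst h hs e b : diffs (h :: hs) (fun=> e) b = 0.
Proof. by rewrite /= diffs_sub; exact: subrr. Qed.

Hypothesis divF : forall a : F, a != 0 -> a \is a GRing.unit.
Hypothesis infF : infinite_set [set: F].

(** Replacing (b, c) by (b + h, c + k) with h + w_i k = 0 leaves the argument of
    the i-th term unchanged. Subtracting, this term disappears and f0, f_j
    become differences of themselves with the other w_j - w_i in their role:
    the equation has the same shape, one term less and right hand side 0. Only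
    finitely many c are ever excluded. *)
Lemma functional_equation_diffs (T : eqType) (s : seq T) (f0 : F -> M) (f : T -> F -> M)
    (w : T -> F) (e : M) (exc : seq F) :
  (forall i, i \in s -> w i != 0) ->
  (forall b c, c \notin exc -> f0 b + \sum_(i <- s) f i (b + w i * c) = e) ->
  forall hs, size hs = (size s).+1 -> forall b, diffs hs f0 b = 0.
Proof.
elim: s f0 f w e exc => [|i s IHs] f0 f w e exc w0 rel [//|h hs] [hsE] b.
  have [c cexc] := exists_notin infF exc.
  have f0E b' : f0 b' = e by have := rel b' c cexc; rewrite big_nil addr0.
  have -> : hs = [::] by case: hs hsE.
  by rewrite /= !f0E subrr.
have wi0 : w i != 0 by apply: w0; apply: mem_head.
pose k := - (w i)^-1 * h.
have wk : - w i * k = h by rewrite /k !mulNr mulrN opprK mulrA mulfVr// mul1r.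
apply: (IHs (fun b => f0 (b + h) - f0 b)
  (fun j b => f j (b + (w j - w i) * k) - f j b) w 0 (exc ++ [seq c - k | c <- exc])) => //.
  by move=> j js; apply: w0; rewrite inE js orbT.
move=> {}b c; rewrite mem_cat negb_or => /andP[cexc ckexc].
have ckexc' : c + k \notin exc.
  by apply: contra ckexc => ckexc; apply/mapP; exists (c + k); rewrite ?addrK.
have := rel (b + h) (c + k) ckexc'; rewrite -(rel b c cexc) !big_cons.
have arg j : b + h + w j * (c + k) = b + w j * c + (w j - w i) * k.
  by rewrite -wk mulrDr mulrBl mulNr; rewrite addrACA [- _ + _]addrC.
rewrite arg subrr mul0r addr0 => /eqP; rewrite -subr_eq0 => /eqP relE.
apply: (etrans _ relE).
have -> : \sum_(j <- s) (f j (b + w j * c + (w j - w i) * k) - f j (b + w j * c)) =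
    \sum_(j <- s) f j (b + h + w j * (c + k)) - \sum_(j <- s) f j (b + w j * c).
  by rewrite -sumrB; apply: eq_bigr => j _; rewrite arg.
by rewrite !opprD [RHS]addrACA; congr (_ + _); rewrite addrACA subrr add0r.
Qed.

(** When the differences of order k + 1 vanish, those of order k do not depend
    on the point; applied to the relation, whose right hand side they kill if
    k >= 1, they come out multiplied by the sum of the coefficients. *)
Lemma diffs_vanish_descent (T : Type) (s : seq T) (a : T -> K) (w : T -> F) f e n :
  \sum_(i <- s) a i != 0 -> (forall b, \sum_(i <- s) a i *: f (b + w i) = e) ->
  (forall hs, size hs = n.+1 -> forall b, diffs hs f b = 0) ->
  forall b b', f b = f b'.
Proof.
move=> a0 rel; elim: n => [|n IHn] vanish.
  move=> b b'; have /eqP := vanish [:: b - b'] erefl b'.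
  by rewrite /= [b' + _]addrC subrK subr_eq0 => /eqP.
apply: IHn => -[//|h hs] hsE b.
have /eqP := diffs_cst h hs e b.
rewrite -(eq_diffs _ (f := fun b => \sum_(i <- s) a i *: f (b + w i)))//.
rewrite (diffs_sum (h :: hs) s a (fun i b => f (b + w i))).
under eq_bigr => i _.
  rewrite diffs_shift (_ : diffs _ f (b + w i) = diffs (h :: hs) f b); first over.
  apply/eqP; rewrite -subr_eq0 -diffs_shift -diffs_sub.
  by apply/eqP/(vanish (w i :: h :: hs)); rewrite /= -hsE.
by rewrite -scaler_suml scaler_eq0 (negbTE a0) => /eqP.
Qed.

End FiniteDifferences.

(** * The projective line of a pencil *)

Section Pencil.
Variables (F : unitRingType) (V : lmodType F) (I I' : Type) (K : fieldType).
Hypothesis divF : forall a : F, a != 0 -> a \is a GRing.unit.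
Hypothesis infF : infinite_set [set: F].
Local Notation Gr := (Gr V I I').
Implicit Types (P Q : Gr) (A B W : submodule V).

Lemma adjoin_comm A p q : adjoin (adjoin A p) q = adjoin (adjoin A q) p.
Proof.
apply/submodule_inj/seteqP; split; apply: adjoin_sub;
  try (apply: adjoin_sub; [exact: subset_trans (@adjoin_base _ _ _ _) (@adjoin_base _ _ _ _)|]);
  by [exact: adjoin_mem|exact/adjoin_base/adjoin_mem].
Qed.

(** Any point A + Fq of the pencil can serve as the point at infinity: some p'
    completes q to a basis of the same plane modulo A. *)
Lemma pencil_complement A p v q : ~ A p -> ~ adjoin A p v -> ~ A q ->
  adjoin (adjoin A p) v q ->
  exists p', ~ adjoin A q p' /\ adjoin (adjoin A q) p' = adjoin (adjoin A p) v.
Proof.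
move=> nAp nPv nAq Bq; have [Pq|nPq] := pselect (adjoin A p q).
  by exists v; rewrite (adjoin_exchange divF Pq nAq).
exists p; split=> [qp|]; last by rewrite adjoin_comm (adjoin_exchange divF Bq nPq).
by apply: nPq; rewrite (adjoin_exchange divF qp nAp); apply: adjoin_mem.
Qed.

(** In the chart (p, q) the finite points are the A + F(p + w q), with w their
    coordinate, and A + Fq is the point at infinity. *)
Section Chart.
Variables (A : submodule V) (p q : V).
Hypotheses (nAq : ~ A q) (nQp : ~ adjoin A q p).

Let nPq : ~ adjoin A p q.
Proof.
move=> Pq; apply: nQp; rewrite (adjoin_exchange divF Pq nAq).
exact: adjoin_mem.
Qed.

(** A dilation of q followed by a transvection. The induced map on coordinates
    is w |-> b + w c, with c on the right as maps of left vector spaces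
    require. *)
Lemma chart_affine_action b c : c != 0 -> exists g : GL V,
  [/\ forall a, A a -> g a = a, g p = p + b *: q & g q = c *: q].
Proof.
move=> c0.
have [f [fA fp]] := exists_functional divF nQp.
have [h [hA hq]] := exists_functional divF nPq.
have fA0 a : A a -> f a = 0 by move=> Aa; apply/fA/adjoin_base.
have hA0 a : A a -> h a = 0 by move=> Aa; apply/hA/adjoin_base.
have fq : f q = 0 by apply/fA/adjoin_mem.
have hp : h p = 0 by apply/hA/adjoin_mem.
have [|d dE] := @exists_shear _ _ divF h ((c - 1) *: q).
  by rewrite linearZ_LR /= hq -[_ *: 1]/((c - 1) * 1 : F) mulr1 addrC subrK.
have [|t tE] := @exists_transvection _ _ divF f (b *: q).
  by rewrite linearZ_LR /= fq scaler0.
exists (GL_mul t d); split=> [a Aa||] /=.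
- by rewrite dE hA0// scale0r addr0 tE fA0// scale0r addr0.
- by rewrite dE hp scale0r addr0 tE fp scale1r.
- rewrite dE hq scale1r scalerBl scale1r addrC subrK tE.
  by rewrite linearZ_LR /= fq scaler0 scale0r addr0.
Qed.

Lemma chart_image (g : GL V) b c P w : (forall a, A a -> g a = a) ->
    g p = p + b *: q -> g q = c *: q -> P = adjoin A (p + w *: q) :> submodule V ->
  gr_act g P = adjoin A (p + (b + w * c) *: q) :> submodule V.
Proof.
move=> gA gp gq PE; rewrite gr_space_act PE image_sub_adjoin image_sub_fix//.
by rewrite linearD linearZ_LR /= gp gq scalerA scalerDl addrA.
Qed.

Lemma chart_coordinate z : adjoin (adjoin A q) p z -> ~ A z ->
  adjoin A z <> adjoin A q -> exists w, adjoin A z = adjoin A (p + w *: q).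
Proof.
move=> /adjoinP[u [d [/adjoinP[a [c [Aa ->]]] ->]]] nAz zq.
have d0 : d != 0.
  apply: contra_notN zq => /eqP d0; apply: (adjoin_exchange divF _ nAz).
  by rewrite d0 scale0r addr0; apply/adjoinP; exists a, c.
exists (d^-1 * c).
have zE : a + c *: q + d *: p = a + d *: (p + (d^-1 * c) *: q).
  by rewrite scalerDr scalerA mulrA mulfVr// mul1r [d *: p + _]addrC addrA.
rewrite zE in nAz *; apply: (adjoin_exchange divF _ nAz).
by apply/adjoinP; exists a, d.
Qed.

Variables (N : set {freeg Gr / K}) (y : {freeg Gr / K}).
Hypotheses (Nrep : subrep (free_act K) N) (Ny : N y).
Let at_infinity P : bool := `[< P = adjoin A q :> submodule V >].
Hypothesis y_pencil : forall P, P \in dom y ->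
  exists z, [/\ P = adjoin A z :> submodule V, ~ A z & adjoin (adjoin A q) p z].
Hypothesis y_sum : \sum_(P <- dom y | ~~ at_infinity P) coeff P y != 0.

(** The functional equation of the coordinate function f, read in K[Gr]/N,
    forces f to be constant. *)
Lemma pencil_neighbours : exists P Q, neighbours P Q /\ N (<< P >> - << Q >>).
Proof.
have coord P : exists w, P \in dom y -> ~~ at_infinity P ->
    P = adjoin A (p + w *: q) :> submodule V.
  have [Py|nPy] := boolP (P \in dom y); last by exists 0.
  have [Pinf|/asboolP nPinf] := boolP (at_infinity P); first by exists 0.
  have [z [PE nAz Bz]] := y_pencil Py.
  by have [|w zE] := chart_coordinate Bz nAz; [rewrite -PE|exists w; rewrite PE zE].
have {coord}[w wP] := choice coord.
have [P1 P1y P1fin] : exists2 P1, P1 \in dom y & ~~ at_infinity P1.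
  apply: contrapT => none; move/negP: y_sum; apply; rewrite big1_seq// => P /andP[Pfin Py].
  by case: none; exists P.
have P1E := wP _ P1y P1fin.
have ex_line t : exists P, P = adjoin A (p + t *: q) :> submodule V.
  have [g [gA gp gq]] := chart_affine_action (t - w P1) (oner_neq0 _).
  exists (gr_act g P1); rewrite (chart_image gA gp gq P1E).
  by rewrite mulr1 subrK.
have {ex_line}[line lineE] := choice ex_line.
pose N' : submodule {freeg Gr / K} := Submodule Nrep.1.
pose f t := quotproj N' << line t >>.
pose e := - \sum_(P <- dom y | at_infinity P) coeff P y *: quotproj N' << P >>.
(* The points at infinity are fixed by the affine group, so they only
   contribute the constant e. *)
have rel b c : c != 0 ->
    \sum_(P <- dom y | ~~ at_infinity P) coeff P y *: f (b + w P * c) = e.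
  move=> c0; have [g [gA gp gq]] := chart_affine_action b c0.
  apply/eqP; rewrite /e -subr_eq0 opprK addrC.
  have gy0 : quotproj N' (free_act K g y) = 0.
    by rewrite -[RHS](linear0 (quotproj N')); apply/eq_quotmod; rewrite subr0; apply: Nrep.2.
  apply/eqP; apply: (etrans _ gy0).
  rewrite free_act_expand linear_sum [RHS](bigID at_infinity) /=.
  congr (_ + _); rewrite big_seq_cond [RHS]big_seq_cond.
    apply: eq_bigr => P /andP[_ /asboolP PE].
    rewrite linearZ /=; congr (_ *: quotproj _ << _ >>).
    apply: gr_eq; rewrite gr_space_act PE image_sub_adjoin gq image_sub_fix//.
    apply/submodule_inj/seteqP; split; apply: adjoin_sub; do ?exact: adjoin_base.
      by apply: (sub_scaleK divF c0); apply: adjoin_mem.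
    exact/sub_scale/adjoin_mem.
  apply: eq_bigr => P /andP[Py Pfin]; rewrite linearZ /= /f.
  congr (_ *: quotproj _ << _ >>); apply: gr_eq.
  by rewrite lineE (chart_image gA gp gq (wP _ Py Pfin)).
pose fin := [seq P <- dom y | ~~ at_infinity P].
have finP P : P \in fin -> P \in dom y /\ ~~ at_infinity P.
  by rewrite mem_filter => /andP[].
have P1fin' : P1 \in fin by rewrite mem_filter P1fin.
(* Translating by the coordinate of P1 makes its argument equal to b. *)
pose s := rem P1 fin.
have vanish hs : size hs = (size s).+1 -> forall b, diffs hs f b = 0.
  move=> hsE b; have a0 : coeff P1 y != 0 by rewrite -mem_dom.
  suff : diffs hs (fun b => \sum_(i <- [:: tt]) coeff P1 y *: f b) b = 0.
    rewrite (@diffs_sum _ _ _ hs _ [:: tt] (fun=> coeff P1 y) (fun=> f)) big_seq1.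
    by move=> /eqP; rewrite scaler_eq0 (negbTE a0) => /eqP.
  apply: (@functional_equation_diffs _ _ _ divF infF _ s _
    (fun P b => coeff P y *: f b) (fun P => w P - w P1) e [:: 0]) => //.
    move=> P; rewrite mem_rem_uniq ?filter_uniq ?uniq_dom// inE => /andP[PP1 /finP[Py Pfin]].
    rewrite subr_eq0; apply: contraNneq PP1 => wE; apply/eqP/gr_eq.
    by rewrite (wP _ Py Pfin) P1E wE.
  move=> {}b c; rewrite inE => c0; rewrite -(rel (b - w P1 * c) c c0).
  rewrite -[RHS]big_filter -/fin [RHS](big_rem P1)//= big_seq1 subrK; congr (_ + _).
  by apply: eq_bigr => P _; rewrite mulrBl addrCA addrC -addrA addrC.
have fcst b b' : f b = f b'.
  apply: (@diffs_vanish_descent _ _ _ _ fin (fun P => coeff P y) (fun P => w P) f e _ _ _ vanish).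
    by rewrite big_filter.
  move=> {}b; rewrite big_filter -(rel b 1 (oner_neq0 _)).
  by apply: eq_bigr => P _; rewrite mulr1.
exists (line 0), (line 1); split; last by have /eq_quotmod := fcst 0 1.
exists A, (p + 0 *: q), (p + 1 *: q); split; rewrite ?lineE//.
  by rewrite scale0r addr0 => /(@adjoin_base _ _ A q).
rewrite scale0r addr0 scale1r => Pq; apply: nPq.
rewrite -[q](addrK p) [q + p]addrC; apply: sub_diff => //; exact: adjoin_mem.
Qed.

End Chart.
End Pencil.

Section MinimalSubrepresentation.
Variables (F : unitRingType) (V : lmodType F) (I I' : Type) (K : fieldType).
Hypothesis divF : forall a : F, a != 0 -> a \is a GRing.unit.
Hypothesis infF : infinite_set [set: F].
Local Notation Gr := (Gr V I I').

(** The sum over the finite points is the total of y minus the coefficient at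
    infinity. When the total is zero, infinity is taken in the support; when it
    is not, infinity is taken off the support, which leaves infinitely many
    choices v + t p. *)
Lemma subrep_neighbours (N : set {freeg Gr / K}) :
  inhabited I -> inhabited I' -> subrep (free_act K) N -> N <> [set 0] ->
  exists P Q, neighbours P Q /\ N (<< P >> - << Q >>).
Proof.
move=> I0 I'0 Nrep Nnz.
have [x Nx x0] : exists2 x, N x & x <> 0.
  apply: contrapT => none; apply: Nnz; apply/seteqP; split=> [x Nx|_ ->].
    by apply: contrapT => x0; apply: none; exists x.
  exact: (sub_zero (Submodule Nrep.1)).
have [A [p [v [P0 [y [P0E nAp nP0v [Ny y0] yP]]]]]] :=
  reduce_to_pencil divF infF Nrep I0 I'0 Nx x0.
rewrite P0E in nP0v.
suff [q [nAq Bq ysum]] : exists q, [/\ ~ A q, adjoin (adjoin A p) v q &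
    \sum_(P <- dom y | ~~ `[< P = adjoin A q :> submodule V >]) coeff P y != 0].
  have [p' [nQp' BE]] := pencil_complement divF nAp nP0v nAq Bq.
  apply: (pencil_neighbours divF infF nAq nQp' Nrep Ny) ysum => P /yP[z [PE nAz Bz]].
  by exists z; split=> //; rewrite BE -P0E.
have [y_sum0|y_sum] := eqVneq (total y) 0.
  have [P Py] := freeg_neq0_dom y0; have [q [PE nAq Bq]] := yP P Py.
  exists q; split; rewrite -?P0E//.
  have : - coeff P y != 0 by rewrite oppr_eq0 -mem_dom.
  apply: contraNneq => sum0; have := y_sum0.
  rewrite totalE (bigID (fun Q : Gr => `[< Q = adjoin A q :> submodule V >])) /= sum0 addr0.
  rewrite (eq_bigl (pred1 P)) => [|Q]; last first.
    by apply/asboolP/eqP => [QE|->//]; apply: gr_eq; rewrite QE.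
  by rewrite -big_filter filter_pred1_uniq ?uniq_dom// big_seq1 => ->; rewrite oppr0.
have nAvp t : ~ adjoin A p (v + t *: p).
  move=> vp; apply: nP0v; rewrite -[v](addrK (t *: p)).
  by apply: sub_diff => //; apply/sub_scale/adjoin_mem.
have [Q _|t tP] := @exists_avoiding F infF Gr (dom y)
    (fun Q t => Q <> adjoin A (v + t *: p) :> submodule V).
  have [[b QE]|none] := pselect (exists b, Q = adjoin A (v + b *: p) :> submodule V);
    last by exists 0 => t _ QE; apply: none; exists t.
  exists b => t /eqP tb QE'; apply: tb.
  have nQp : ~ Q p.
    rewrite QE => pv; apply: (nAvp b).
    by rewrite (adjoin_exchange divF pv nAp); apply: adjoin_mem.
  by apply: (affine_line_meets divF nQp (v := v)); [rewrite QE'|rewrite QE]; apply: adjoin_mem.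
exists (v + t *: p); split.
- by move=> /(@adjoin_base _ _ A p); apply: nAvp.
- by apply: sub_add; [apply: adjoin_mem|apply/sub_scale/adjoin_base/adjoin_mem].
- rewrite -[X in X != 0](_ : total y = _)//.
  rewrite totalE big_seq [RHS]big_seq_cond; apply: eq_bigl => Q.
  by have [/tP Qy|//] := boolP (Q \in dom y); rewrite andTb; apply/esym/asboolPn.
Qed.

Lemma subrep_contains_neighbours (N : set {freeg Gr / K}) (P Q : Gr) :
  inhabited I -> inhabited I' -> subrep (free_act K) N -> N <> [set 0] ->
  neighbours P Q -> N (<< P >> - << Q >>).
Proof.
move=> I0 I'0 Nrep Nnz PQ.
have [P' [Q' [PQ' NPQ']]] := subrep_neighbours I0 I'0 Nrep Nnz.
have [g [<- <-]] := GL_transitive_neighbours divF infF PQ' PQ.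
by rewrite -!free_actU -linearB; apply: Nrep.2.
Qed.

End MinimalSubrepresentation.

(** * Base change and the representation generated by M1 *)

Section BaseChange.
Variables (F : nzRingType) (V : lmodType F) (I I' : Type) (K : nzRingType).
Local Notation Gr := (Gr V I I').
Implicit Types (P Q : Gr) (x y : {freeg Gr / int}).

Lemma coeff_base_change P x : coeff P (base_change K x) = (coeff P x)%:~R.
Proof.
rewrite /base_change (big_morph _ (coeffD _) (coeff0 _ _)).
rewrite -[in RHS](coeff_expand x P) rmorph_sum; apply: eq_bigr => Q _ /=.
by rewrite coeffU rmorphM; case: (Q == P).
Qed.

Lemma base_change_lin (a : int) x y :
  base_change K (a *: x + y) = a%:~R *: base_change K x + base_change K y.
Proof.
apply: freeg_ext => P.
by rewrite coeffD coeffZ !coeff_base_change coeffD coeffZ rmorphD rmorphM.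
Qed.

Lemma base_change_free_act g x :
  base_change K (free_act int g x) = free_act K g (base_change K x).
Proof.
apply: freeg_ext => Q; have [P <-] := gr_act_surj g Q.
by rewrite coeff_free_act !coeff_base_change coeff_free_act.
Qed.

Lemma base_changeB x y : base_change K (x - y) = base_change K x - base_change K y.
Proof.
by rewrite -[x - y]addrC -[- y]scaleN1r base_change_lin mulrN1z scaleN1r addrC.
Qed.

Lemma base_changeU P : base_change K << P >> = << P >>.
Proof.
by apply: freeg_ext => Q; rewrite coeff_base_change !coeffU !mul1r; case: (P == Q).
Qed.

Lemma M1_subrep (L L' : Gr) : subrep (free_act int) (M1 L L').
Proof.
split=> [|g x M1x N [Nrep LN]].
  apply/is_submoduleP; split=> [N [[/is_submoduleP[N0 _] _] _]//|a x y M1x M1y N [Nrep LN]].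
  by have [/is_submoduleP[_ Nlin] _] := Nrep; apply: Nlin; [apply: M1x|apply: M1y].
by have [_ Nact] := Nrep; apply: Nact; apply: M1x.
Qed.

Lemma M1_gen (L L' : Gr) : M1 L L' (<< L >> - << L' >>).
Proof. exact: sub_gen_smallest. Qed.

Lemma zero_sum_diff (A : nzRingType) P Q : zero_sum A Gr (<< P >> - << Q >>).
Proof. by apply/zero_sumP; rewrite linearB /= !totalU subrr. Qed.

Lemma zero_sum_subrep (A : nzRingType) : subrep (free_act A) (zero_sum A Gr).
Proof.
split=> [|g x /zero_sumP x0]; first exact: zero_sum_is_submodule.
by apply/zero_sumP; rewrite total_free_act.
Qed.

Lemma M1_zero_sum (L L' : Gr) : M1 L L' `<=` zero_sum int Gr.
Proof.
apply: smallest_sub; first exact: zero_sum_subrep.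
by move=> _ ->; apply: zero_sum_diff.
Qed.

Lemma KM1_subrep (L L' : Gr) : subrep (free_act K) (KM1 K L L').
Proof.
split=> [|g x KM1x]; first exact: submodule_closed.
have : (free_act K g @` KM1 K L L') (free_act K g x) by exists x.
rewrite (image_span (free_act K g)); apply: span_mono => _ [_ [y My <-] <-].
exists (free_act int g y); last exact: base_change_free_act.
by have [_] := M1_subrep L L'; apply.
Qed.

Lemma KM1_gen (L L' : Gr) : KM1 K L L' (<< L >> - << L' >>).
Proof.
apply: span_gen; exists (<< L >> - << L' >>); first exact: M1_gen.
by rewrite base_changeB !base_changeU.
Qed.

Lemma KM1_sub (L L' : Gr) (N : set {freeg Gr / K}) :
  subrep (free_act K) N -> N (<< L >> - << L' >>) -> KM1 K L L' `<=` N.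
Proof.
move=> [Nsub Nact] NLL'.
apply: (@span_sub _ _ _ (Submodule Nsub)) => _ [x + <-].
apply: (@smallest_sub _ _ _ [set x | N (base_change K x)]); last first.
  by move=> _ ->; rewrite /mkset base_changeB !base_changeU.
have /is_submoduleP[N0 Nlin] := Nsub.
split=> [|g y Ny]; last by rewrite /mkset base_change_free_act; apply: Nact.
apply/is_submoduleP; split=> [|a y z Ny Nz].
  by have := N0; rewrite /mkset -[0](subrr (base_change K 0)) -base_changeB subrr.
by rewrite /mkset base_change_lin; apply: Nlin.
Qed.

End BaseChange.

(** * Finite dimension or codimension *)

Section FiniteCase.
Variables (F : unitRingType) (V : lmodType F).
Hypothesis divF : forall a : F, a != 0 -> a \is a GRing.unit.
Hypothesis infF : infinite_set [set: F].
Implicit Types (U W A : submodule V).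

Fixpoint flag n U W : Prop :=
  if n is m.+1 then exists v, ~ U v /\ flag m (adjoin U v) W else U = W.

Lemma flag_of_basis (B C : set V) (s : seq V) : lin_indep B -> C `<=` B -> uniq s ->
  [set` s] `<=` B -> (forall v, v \in s -> ~ C v) ->
  flag (size s) (span C) (span (C `|` [set` s])).
Proof.
move=> Bfree; elim: s C => [|v s IHs] C CB us sB sC.
  by rewrite /=; congr (span _); apply/seteqP; split=> [x Cx|x []//]; left.
have /andP[vs us'] := us.
have Bv : B v by apply: sB; apply: mem_head.
have nCv : ~ C v by apply: sC; apply: mem_head.
exists v; split; first exact: (lin_indep_notin_span Bfree CB Bv nCv).
have -> : adjoin (span C) v = span (C `|` [set v]).
  apply/submodule_inj/seteqP; split.
    apply: adjoin_sub; first by apply: span_mono => x; left.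
    by apply: span_gen; right.
  apply: span_sub => x [Cx|->]; last exact: adjoin_mem.
  by apply: adjoin_base; apply: span_gen.
have -> : C `|` [set` v :: s] = (C `|` [set v]) `|` [set` s].
  apply/seteqP; split=> x.
    by move=> [Cx|]; [left; left|rewrite /= inE => /predU1P[->|]; [left; right|right]].
  by move=> [[Cx|->]|xs]; [left|right; apply: mem_head|right; rewrite /= inE xs orbT].
apply: IHs => //.
- by move=> x [/CB|->].
- by move=> x xs; apply: sB; rewrite /= inE xs orbT.
- move=> x xs [Cx|xv]; first by apply: (sC x) => //; rewrite inE xs orbT.
  by move: vs; rewrite -xv xs.
Qed.

(** In the application E consists of the g moving each member of Gr within its
    class modulo M1. *)
Variable E : set (GL V).
Hypothesis EM : forall g h, E g -> E h -> E (GL_mul g h).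
Hypothesis Eshear : forall g, is_shear g -> E g.

(** Once the bottoms of two flags agree, the vectors added at each step are
    exchanged by shears fixing the part already aligned. *)
Lemma flag_align_top n U W U' W' h : flag n U W -> flag n U' W' ->
  E h -> image_sub h U = U' -> exists2 h', E h' & image_sub h' W = W'.
Proof.
elim: n U U' h => [|n IHn] U U' h /=; first by move=> -> -> Eh hU; exists h.
move=> [v [nUv UW]] [v' [nUv' UW']] Eh hU.
have nUhv : ~ U' (h v) by rewrite -hU image_sub_mem.
have [g [gshear gU gv]] := shear_replaces_vector divF infF nUhv nUv'.
apply: IHn UW UW' (EM (Eshear gshear) Eh) _.
by rewrite image_sub_mul !image_sub_adjoin gv hU image_sub_fix.
Qed.

(** Once the tops of two flags agree, the hyperplanes are exchanged one after
    the other by shears preserving the part already aligned. *)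
Lemma flag_align_bottom n U W U' W' h : flag n U W -> flag n U' W' ->
  E h -> image_sub h W = W' -> exists2 h', E h' & image_sub h' U = U'.
Proof.
elim: n U U' => [|n IHn] U U' /=; first by move=> -> -> Eh hU; exists h.
move=> [v [nUv UW]] [v' [nUv' UW']] Eh hW.
have [h1 Eh1 h1v] := IHn _ _ UW UW' Eh hW.
have nUhv : ~ image_sub h1 U (h1 v) by rewrite image_sub_mem.
have vE : adjoin U' v' = adjoin (image_sub h1 U) (h1 v) by rewrite -image_sub_adjoin.
have [g [gshear _ gU]] := shear_replaces_hyperplane divF vE nUhv erefl nUv'.
exists (GL_mul g h1); first exact: EM (Eshear gshear) Eh1.
by rewrite image_sub_mul; apply: submodule_inj.
Qed.

End FiniteCase.

Section FiniteTransitivity.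
Variables (F : unitRingType) (V : lmodType F) (I I' : Type).
Hypothesis divF : forall a : F, a != 0 -> a \is a GRing.unit.
Hypothesis infF : infinite_set [set: F].
Local Notation Gr := (Gr V I I').
Implicit Types (P Q : Gr).

(** g fixes pointwise the trace A of Q on the kernel of phi, and Q = A + Fq. *)
Lemma shear_moves_to_neighbour (g : GL V) Q :
  is_shear g -> gr_act g Q = Q \/ neighbours (gr_act g Q) Q.
Proof.
move=> [phi [w gE]].
have [phiQ|nphiQ] := pselect (forall q, Q q -> phi q = 0).
  left; apply: gr_eq; rewrite gr_space_act; apply: image_sub_fix => q Qq.
  by rewrite gE phiQ// scale0r addr0.
have [q Qq phiq] : exists2 q, Q q & phi q != 0.
  apply: contrapT => none; apply: nphiQ => q Qq; apply: contrapT => /eqP phiq.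
  by apply: none; exists q.
pose A := submoduleI Q (kernel phi).
have [QE nAq] := adjoin_kernel_trace divF Qq phiq.
rewrite -/A in QE nAq.
have gA a : A a -> g a = a by move=> [_ phia]; rewrite gE phia scale0r addr0.
have gQE : gr_act g Q = adjoin A (g q) :> submodule V.
  by rewrite gr_space_act QE image_sub_adjoin image_sub_fix.
have [gq|ngq] := pselect (gr_act g Q q); [left|right].
  by apply: gr_eq; rewrite QE gQE; apply/esym/(adjoin_exchange divF) => //; rewrite -gQE.
exists A, (g q), q; split=> // Agq; apply: nAq.
by have := gA _ Agq => /(bij_inj (gl_bij g)) <-.
Qed.

Lemma finite_seq_uniq (T : choiceType) (B : set T) : finite_set B ->
  exists s, uniq s /\ B = [set` s].
Proof.
move=> /finite_seqP[s ->]; exists (undup s); split; first exact: undup_uniq.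
by apply/seteqP; split=> x /=; rewrite mem_undup.
Qed.

(** A finite basis of P is a flag from 0 to P, to be aligned from the bottom; a
    finite basis of V / P is a flag from P to V, to be aligned from the top. *)
Lemma finite_transitive (E : set (GL V)) P Q :
  E (GL_one V) -> (forall g h, E g -> E h -> E (GL_mul g h)) ->
  (forall g, is_shear g -> E g) ->
  finite_set [set: I] \/ finite_set [set: I'] ->
  exists2 g, E g & gr_act g P = Q.
Proof.
move=> E1 EM Eshear fin.
have [B [D [[Efree BD BP ET] BI DI]]] := exists_adapted_basis P.
have [B' [D' [[E'free BD' BQ E'T] BI' DI']]] := exists_adapted_basis Q.
suff [g Eg gPQ] : exists2 g, E g & image_sub g P = Q.
  by exists g => //; apply: gr_eq; rewrite gr_space_act.
have PE : gr_space P = span B by apply: submodule_inj.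
have QE : gr_space Q = span B' by apply: submodule_inj.
have image_list (X X' : set V) (s t : V -> V) (l : seq V) : uniq l -> X = [set` l] ->
    (forall x, X x -> X' (s x) /\ t (s x) = x) -> (forall y, X' y -> X (t y) /\ s (t y) = y) ->
    uniq (map s l) /\ X' = [set` map s l].
  move=> ul -> st ts; split.
    rewrite map_inj_in_uniq// => x y xl yl e.
    by have [_ <-] := st x xl; have [_ <-] := st y yl; rewrite e.
  apply/seteqP; split=> [y X'y|_ /mapP[x xl ->]]; last by have [] := st x xl.
  by have [ty <-] := ts y X'y; apply: map_f.
case: fin => fin.
  have [s [t [st ts]]] := card_eq_inverses 0 (card_eq_trans BI (card_esym BI')).
  have [l [ul lE]] : exists s, uniq s /\ B = [set` s].
    by apply: finite_seq_uniq; rewrite (eq_finite_set BI).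
  have [ul' lE'] := image_list _ _ _ _ _ ul lE st ts.
  have fP : flag (size l) (span set0) (span B).
    rewrite -[B]set0U lE; apply: (flag_of_basis Efree) => [x []|//|x xl|v _ []].
    by left; rewrite lE.
  have fQ : flag (size l) (span set0) (span B').
    rewrite -[B']set0U lE' -(size_map s); apply: (flag_of_basis E'free) => [x []|//|x xl|v _ []].
    by left; rewrite lE'.
  rewrite PE QE; apply: (flag_align_top divF infF EM Eshear fP fQ E1).
  exact: image_sub_fix.
have [s [t [st ts]]] := card_eq_inverses 0 (card_eq_trans DI (card_esym DI')).
have [l [ul lE]] : exists s, uniq s /\ D = [set` s].
  by apply: finite_seq_uniq; rewrite (eq_finite_set DI).
have [ul' lE'] := image_list _ _ _ _ _ ul lE st ts.
have fP : flag (size l) (span B) (span (B `|` D)).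
  rewrite lE; apply: (flag_of_basis Efree) => [x Bx|//|x xl|x xl /BD].
  - by left.
  - by right; rewrite lE.
  - by apply; rewrite lE.
have fQ : flag (size l) (span B') (span (B' `|` D')).
  rewrite lE' -(size_map s); apply: (flag_of_basis E'free) => [x Bx|//|x xl|x xl /BD'].
  - by left.
  - by right; rewrite lE'.
  - by apply; rewrite lE'.
have TT : span (B `|` D) = span (B' `|` D') by apply: submodule_inj; rewrite ET E'T.
rewrite PE QE; rewrite TT in fP.
apply: (flag_align_bottom divF EM Eshear fP fQ E1).
exact: image_sub_fix.
Qed.

(** The g with [g R] - [R] in M for all R form a monoid containing the
    shears. *)
Lemma finite_differences_generated (M : submodule {freeg Gr / int}) :
  finite_set [set: I] \/ finite_set [set: I'] ->
  (forall P Q, neighbours P Q -> M (<< P >> - << Q >>)) ->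
  forall P Q, M (<< P >> - << Q >>).
Proof.
move=> fin Mnb P Q.
pose E : set (GL V) := [set g | forall R : Gr, M (<< gr_act g R >> - << R >>)].
have [|g h Eg Eh R|g gshear R|g Eg <-] := @finite_transitive E Q P _ _ _ fin.
- by move=> R; rewrite gr_act_one subrr; apply: sub_zero.
- by have := sub_add (Eg (gr_act h R)) (Eh R); rewrite addrA subrK -gr_act_mul.
- have [->|gR] := shear_moves_to_neighbour R gshear; last exact: Mnb.
  by rewrite subrr; apply: sub_zero.
- exact: Eg.
Qed.

End FiniteTransitivity.

(** * Infinite dimension and codimension *)

Section InfiniteCase.
Variables (F : nzRingType) (V : lmodType F) (I I' : Type).
Local Notation Gr := (Gr V I I').
Implicit Types (P Q : Gr).

Definition almost_below P Q : Prop :=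
  exists s : seq V, Q `<=` span (P `|` [set` s]).

Lemma almost_below_neighbours L P Q A p q :
  P = adjoin A p :> submodule V -> Q = adjoin A q :> submodule V ->
  almost_below L P -> almost_below L Q.
Proof.
move=> PE QE [s Ps]; exists (q :: s); rewrite QE; apply: adjoin_sub.
  move=> a Aa; have := Ps a; rewrite PE => /(_ (adjoin_base p Aa)).
  by apply: span_mono => x [Lx|xs]; [left|right; rewrite /= inE xs orbT].
by apply: span_gen; right; apply: mem_head.
Qed.

Lemma infinite_sequence (B : set V) : infinite_set B ->
  exists f : nat -> V, injective f /\ forall n, B (f n).
Proof.
pose V' : pointedType := HB.pack_for pointedType (V : choiceType) (isPointed.Build V 0).
move=> /infiniteP/(@pcard_leP _ V')/injfunPex[f fB finj]; exists f; split=> [m n|n].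
  by apply: finj; rewrite inE.
exact: fB.
Qed.

Lemma exists_swap (T : choiceType) (f f' : nat -> T) :
  injective f -> injective f' -> (forall m n, f m <> f' n) ->
  exists s : T -> T, [/\ involutive s, forall n, s (f n) = f' n, forall n, s (f' n) = f n &
    forall x, s x = x \/ exists n, x = f n \/ x = f' n].
Proof.
move=> finj f'inj ff'.
have [s sP] : exists s : T -> T, forall x, [/\ forall n, x = f n -> s x = f' n,
    forall n, x = f' n -> s x = f n & (forall n, x <> f n /\ x <> f' n) -> s x = x].
  have ex x : exists y, [/\ forall n, x = f n -> y = f' n,
      forall n, x = f' n -> y = f n & (forall n, x <> f n /\ x <> f' n) -> y = x].
    have [[n xn]|nf] := pselect (exists n, x = f n).
      exists (f' n); split=> [m|m|/(_ n)[]//].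
        by rewrite xn => /finj ->.
      by rewrite xn => /ff'.
    have [[n xn]|nf'] := pselect (exists n, x = f' n).
      exists (f n); split=> [m|m|/(_ n)[]//].
        by rewrite xn => /esym/ff'.
      by rewrite xn => /f'inj ->.
    exists x; split=> [m xm|m xm|//]; first by case: nf; exists m.
    by case: nf'; exists m.
  by have [s sP] := choice ex; exists s.
have sf n : s (f n) = f' n by have [+ _ _] := sP (f n); apply.
have sf' n : s (f' n) = f n by have [_ + _] := sP (f' n); apply.
have sE x : s x = x \/ exists n, x = f n \/ x = f' n.
  have [ex|nex] := pselect (exists n, x = f n \/ x = f' n); first by right.
  left; have [_ _] := sP x; apply=> n.
  by split=> xn; apply: nex; exists n; [left|right].
exists s; split=> // x.
by have [sx|[n [->|->]]] := sE x; rewrite ?sx// ?sf ?sf'// sf.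
Qed.

Lemma finite_support (B : set V) (s : seq V) : span B = [set: V] :> set V ->
  exists l : seq V, [set` l] `<=` B /\ [set` s] `<=` span [set` l].
Proof.
move=> BT; elim: s => [|v s [l [lB sl]]]; first by exists [::]; split.
have : submodule_set (span B) v by rewrite BT.
rewrite span_combs => -[k [c [_ kB ->]]]; exists (k ++ l); split.
  by move=> x /=; rewrite mem_cat => /orP[/kB|/lB].
move=> x /=; rewrite inE => /predU1P[->|/sl]; last first.
  by apply: span_mono => y /= yl; rewrite mem_cat yl orbT.
apply: (@sub_sum_seq _ _ (span _)) => y yk; apply: sub_scale; apply: span_gen.
by rewrite /= mem_cat yk.
Qed.

(** Exchange an infinite sequence of the basis B of P with one of the
    complementary basis D: the image of P contains infinitely many elements of
    D, whereas a finite list of vectors involves only finitely many of them. *)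
Lemma exists_not_almost_below P : infinite_set [set: I] -> infinite_set [set: I'] ->
  exists g : GL V, ~ almost_below P (gr_act g P).
Proof.
move=> infI infI'; have [B [D [[Efree BD BP ET] BI DI]]] := exists_adapted_basis P.
have [f [finj fB]] : exists f : nat -> V, injective f /\ forall n, B (f n).
  by apply: infinite_sequence; rewrite (eq_finite_set BI).
have [f' [f'inj f'D]] : exists f : nat -> V, injective f /\ forall n, D (f n).
  by apply: infinite_sequence; rewrite (eq_finite_set DI).
have [|s [sK sf sf' sE]] := exists_swap finj f'inj.
  by move=> m n fm; apply: (BD (f m)); rewrite // fm.
have stable e : (B `|` D) e -> (B `|` D) (s e) /\ s (s e) = e.
  move=> Ee; split; last exact: sK.
  by have [->//|[n [->|->]]] := sE e; rewrite ?sf ?sf'; [right|left].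
have [g gE] := GL_of_bases Efree ET Efree ET stable stable.
exists g => -[l gPl].
have [k [kE lk]] := finite_support l ET.
have [n nk] : exists n, f' n \notin k.
  apply: contrapT => none.
  have : (size (map f' (iota 0 (size k).+1)) <= size k)%N.
    apply: uniq_leq_size; first by rewrite map_inj_uniq ?iota_uniq.
    move=> _ /mapP[n _ ->]; apply: contrapT => /negP nk.
    by apply: none; exists n.
  by rewrite size_map size_iota ltnn.
have f'E : span (B `|` [set` k]) (f' n).
  have gf : submodule_set (gr_act g P) (f' n).
    exists (f n); last by rewrite gE ?sf//; left.
    by rewrite -BP; apply: span_gen.
  apply: (span_sub _ (gPl _ gf)) => x [Px|/lk].
    have : submodule_set (span B) x by rewrite BP.
    by apply: span_mono => y; left.
  by apply: span_mono => y; right.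
apply: (lin_indep_notin_span Efree _ _ _ f'E).
- by move=> x [Bx|/kE//]; left.
- by right; apply: f'D.
- by move=> [/BD|]; [apply|apply/negP].
Qed.

Variable K : nzRingType.

(** The linear form counting, with coefficients, the members almost below L
    vanishes on all differences of neighbours, hence on all translates of the
    generator; it does not vanish on [g L] - [L] when g L is not almost below
    L. *)
Lemma KM1_neq_zero_sum (L L' : Gr) : neighbours L L' ->
  infinite_set [set: I] -> infinite_set [set: I'] ->
  KM1 K L L' <> zero_sum K Gr :> set _.
Proof.
move=> nLL' infI infI' KM1E.
have [g ngL] := exists_not_almost_below L infI infI'.
pose chi Q : K := (`[< almost_below L Q >])%:R.
have : [set x | forall h, weighted_sum chi (free_act K h x) = 0] (<< gr_act g L >> - << L >>).
  apply: (@KM1_sub _ _ _ _ _ L L'); last by rewrite KM1E; apply: zero_sum_diff.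
    split=> [|h x x0 h']; last first.
      have <- : free_act K (GL_mul h' h) x = free_act K h' (free_act K h x).
        apply: freeg_ext => Q; have [P <-] := gr_act_surj (GL_mul h' h) Q.
        by rewrite coeff_free_act gr_act_mul !coeff_free_act.
      exact: x0.
    apply/is_submoduleP; split=> [h|a x y x0 y0 h]; first by rewrite !linear0.
    by rewrite 2!linearP /= x0 y0 scaler0 addr0.
  move=> h; rewrite !linearB /= !free_actU !weighted_sumU.
  have [A [p [q [_ _ LE L'E]]]] := neighbours_act h nLL'.
  apply/eqP; rewrite subr_eq0 /chi; apply/eqP; congr (_%:R); congr nat_of_bool.
  apply/asbool_equiv_eq; split; first exact: almost_below_neighbours LE L'E.
  exact: almost_below_neighbours L'E LE.
move=> /(_ (GL_one V)).
have -> : free_act K (GL_one V) (<< gr_act g L >> - << L >>) = << gr_act g L >> - << L >>.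
  by rewrite linearB /= !free_actU !gr_act_one.
rewrite linearB /= !weighted_sumU /chi asboolF// asboolT; last first.
  by exists [::] => x Lx; apply: span_gen; left.
by rewrite sub0r => /eqP; rewrite oppr_eq0 oner_eq0.
Qed.

End InfiniteCase.

(** * The smallest subrepresentation and the equivalent conditions *)

Section Consequences.
Variables (F : unitRingType) (K : fieldType) (V : lmodType F) (I I' : Type).
Variables (L L' : Gr V I I').
Hypothesis divF : forall a : F, a != 0 -> a \is a GRing.unit.
Hypothesis infF : infinite_set [set: F].
Hypotheses (I0 : inhabited I) (I'0 : inhabited I').
Hypothesis nLL' : neighbours L L'.
Local Notation Gr := (Gr V I I').
Local Notation KM := (KM1 K L L').
Local Notation zeroK := (zero_sum K Gr).

Lemma KM1_minimal (N : set {freeg Gr / K}) :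
  subrep (free_act K) N -> N <> [set 0] -> KM `<=` N.
Proof.
move=> Nrep Nnz; apply: KM1_sub => //.
exact: (subrep_contains_neighbours divF infF).
Qed.

Lemma KM1_nonzero : KM <> [set 0] :> set _.
Proof.
move=> KM0; have : KM (<< L >> - << L' >>) := @KM1_gen _ _ _ _ K L L'.
rewrite /contains KM0 => /(congr1 (coeff L)).
rewrite coeff0 coeffB !coeffU eqxx mul1r; have [L'L|_] := eqVneq L' L.
  have [A [p [q [_ nLq _ L'E]]]] := nLL'; case: nLq.
  by rewrite -L'L L'E; apply: adjoin_mem.
by rewrite mulr0 subr0 => /eqP; rewrite oner_eq0.
Qed.

Lemma KM1_irreducible : irreducible (free_act K) KM.
Proof.
split; [exact: KM1_subrep|exact: KM1_nonzero|move=> N Nrep NKM].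
have [->|Nnz] := pselect (N = [set 0]); first by left.
by right; apply/seteqP; split=> //; apply: KM1_minimal.
Qed.

Lemma irreducible_is_KM1 (N : set {freeg Gr / K}) : irreducible (free_act K) N -> N = KM.
Proof.
move=> [Nrep Nnz Nirr].
by have [/KM1_nonzero|->] := Nirr _ (@KM1_subrep _ _ _ _ K L L') (KM1_minimal Nrep Nnz).
Qed.

Lemma KM1_zero_sum : KM `<=` zeroK.
Proof. by apply: KM1_sub; [apply: zero_sum_subrep|apply: zero_sum_diff]. Qed.

Lemma M1_of_finite :
  finite_set [set: I] \/ finite_set [set: I'] -> M1 L L' = zero_sum int Gr.
Proof.
move=> fin; have [M1sub M1act] := M1_subrep L L'.
apply/seteqP; split=> [|x /(zero_sum_expand L) ->]; first exact: M1_zero_sum.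
apply: (@sub_sum _ _ (Submodule M1sub)) => P _; apply: sub_scale.
apply: (finite_differences_generated divF infF) => // {}P Q.
move=> /(GL_transitive_neighbours divF infF nLL')[g [<- <-]].
rewrite -!free_actU -linearB; apply: M1act; exact: M1_gen.
Qed.

Lemma KM1_of_M1 : M1 L L' = zero_sum int Gr -> KM = zeroK :> set _.
Proof.
move=> M1E; apply/seteqP; split=> [|x /(zero_sum_expand L) ->]; first exact: KM1_zero_sum.
apply: (@sub_sum _ _ KM) => P _; apply: sub_scale; apply: span_gen.
exists (<< P >> - << L >>); first by rewrite M1E; apply: zero_sum_diff.
by rewrite base_changeB !base_changeU.
Qed.

Lemma zero_sum_irreducible_KM1 : irreducible (free_act K) zeroK -> KM = zeroK :> set _.
Proof. by move=> /irreducible_is_KM1. Qed.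

Lemma quot_act_proj g x :
  quot_act KM (free_act K) g (quotproj KM x) = quotproj KM (free_act K g x).
Proof. by apply: quot_actE; [apply: KM1_subrep|apply: free_actB]. Qed.

Lemma nontrivial_class P : ~ KM << P >>.
Proof.
by move=> /KM1_zero_sum/zero_sumP; rewrite totalU => /eqP; rewrite oner_eq0.
Qed.

(** The sum of coefficients identifies the quotient with K. *)
Lemma quotient_irreducible : KM = zeroK :> set _ ->
  irreducible (quot_act KM (free_act K)) [set: quotmod KM].
Proof.
move=> KME; split.
- by split=> //; apply/is_submoduleP.
- move=> T0; apply: (@nontrivial_class L).
  have : [set: quotmod KM] (quotproj KM << L >>) by [].
  rewrite T0 /= -[0](linear0 (quotproj KM)) => /eq_quotmod.
  by rewrite subr0.
move=> N [Nsub _] _; have /is_submoduleP[N0 _] := Nsub.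
have [->|Nnz] := pselect (N = [set 0]); [by left|right].
pose W := Submodule Nsub.
have [u Nu u0] : exists2 u, N u & u <> 0.
  apply: contrapT => none; apply: Nnz; apply/seteqP; split=> [u Nu|_ ->//].
  by apply: contrapT => u0; apply: none; exists u.
pose d : K := total (repr u).
have d0 : d != 0.
  apply: contra_notN u0 => /eqP du; rewrite -[u]quotprojK -[RHS](linear0 (quotproj KM)).
  by apply/eq_quotmod; rewrite subr0 KME; apply/zero_sumP.
apply/seteqP; split=> // z _; rewrite -[z]quotprojK.
pose c : K := total (repr z) / d.
have -> : quotproj KM (repr z) = c *: u.
  rewrite -[X in _ *: X]quotprojK -linearZ; apply/eq_quotmod; rewrite KME; apply/zero_sumP.
  by rewrite linearB linearZ_LR /= -[_ *: _]/(c * d : K) /c divfK ?subrr.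
exact: (@sub_scale _ _ W).
Qed.

(** The image of the combinations with sum zero is a proper
    subrepresentation, as it misses the class of L; so it is zero, and the sum
    of coefficients descends to an isomorphism with K. *)
Lemma quotient_trivial : irreducible (quot_act KM (free_act K)) [set: quotmod KM] ->
  exists f : {linear quotmod KM -> K^o}, bijective f /\
    forall (g : GL V) (x : quotmod KM), f (quot_act KM (free_act K) g x) = f x.
Proof.
move=> [_ _ irr].
have KME : KM = zeroK :> set _.
  apply/seteqP; split; first exact: KM1_zero_sum.
  have imrep : subrep (quot_act KM (free_act K)) (quotproj KM @` zeroK).
    split=> [|g _ [x x0 <-]]; first exact/image_is_submodule/zero_sum_is_submodule.
    rewrite quot_act_proj; exists (free_act K g x) => //.
    by apply: (zero_sum_subrep _ _ _ _).2.
  have [im0|imT] := irr _ imrep (@subsetT _ _).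
    move=> x x0; have : (quotproj KM @` zeroK) (quotproj KM x) by exists x.
    rewrite im0 /= -[0](linear0 (quotproj KM)) => /eq_quotmod.
    by rewrite subr0.
  have : (quotproj KM @` zeroK) (quotproj KM << L >>) by rewrite imT.
  move=> [x x0 /eq_quotmod/KM1_zero_sum/zero_sumP].
  move/zero_sumP: x0; rewrite linearB /= totalU => ->.
  by rewrite sub0r => /eqP; rewrite oppr_eq0 oner_eq0.
have total_repr x : total (repr (quotproj KM x)) = total x.
  apply/eqP; rewrite -subr_eq0 -linearB; apply/eqP/zero_sumP.
  by rewrite -KME; apply/eq_quotmod; rewrite reprK.
have f_lin : linear (fun x : quotmod KM => total (repr x)).
  move=> a x y; rewrite -{1}[x]quotprojK -{1}[y]quotprojK -linearP /=.
  by rewrite total_repr linearP.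
have [f fE] := exists_linear f_lin; exists f; split.
  exists (fun a => quotproj KM (a *: << L >>)) => [x|a]; rewrite fE.
    rewrite -[RHS]quotprojK; apply/eq_quotmod; rewrite KME; apply/zero_sumP.
    by rewrite linearB linearZ_LR /= totalU -[_ *: 1]/(total (repr x) * 1 : K) mulr1 subrr.
  by rewrite total_repr linearZ_LR /= totalU -[_ *: 1]/(a * 1 : K) mulr1.
move=> g x; rewrite !fE -{1}[x]quotprojK quot_act_proj total_repr.
exact: total_free_act.
Qed.

(** An invariant f takes the same value on all classes of members of Gr, since
    these form one orbit; so f kills their differences, and f is injective. *)
Lemma KM1_of_quotient_trivial (f : {linear quotmod KM -> K^o}) : bijective f ->
  (forall (g : GL V) (x : quotmod KM), f (quot_act KM (free_act K) g x) = f x) ->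
  KM = zeroK :> set _.
Proof.
move=> fbij fG; apply/seteqP; split; first exact: KM1_zero_sum.
move=> x /(zero_sum_expand L) ->; apply: (@sub_sum _ _ KM) => P _; apply: sub_scale.
apply/eq_quotmod/(bij_inj fbij); have [g <-] := GL_transitive L P.
by have := fG g (quotproj KM << L >>); rewrite quot_act_proj free_actU.
Qed.

Lemma finite_of_KM1 : KM = zeroK :> set _ ->
  finite_set [set: I] \/ finite_set [set: I'].
Proof.
move=> KME; have [fin|infI] := pselect (finite_set [set: I]); first by left.
right; apply: contrapT => infI'.
exact: (KM1_neq_zero_sum (K := K) nLL' infI infI').
Qed.

End Consequences.

Theorem corollary4p4 (F : unitRingType) (K : fieldType) (V : lmodType F)
    (I I' : Type) (L L' : Gr V I I') :
  (forall a : F, a != 0 -> a \is a GRing.unit) ->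
  infinite_set [set: F] ->
  inhabited I -> inhabited I' ->
  has_dim [set: V] (I + I')%type ->
  adjacent L L' ->
  [/\ forall N : set {freeg (Gr V I I') / K},
        subrep (free_act K) N -> N <> [set 0] -> KM1 K L L' `<=` N,
      irreducible (free_act K) (KM1 K L L') /\
      (forall N : set {freeg (Gr V I I') / K},
        irreducible (free_act K) N -> N = KM1 K L L') &
      [<-> finite_set [set: I] \/ finite_set [set: I'];
           M1 L L' = zero_sum int (Gr V I I');
           KM1 K L L' = zero_sum K (Gr V I I') :> set _;
           irreducible (free_act K) (zero_sum K (Gr V I I'));
           irreducible (quot_act (KM1 K L L') (free_act K))
             [set: quotmod (KM1 K L L')];
           exists f : {linear quotmod (KM1 K L L') -> K^o}, bijective f /\
             forall (g : GL V) (x : quotmod (KM1 K L L')),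
               f (quot_act (KM1 K L L') (free_act K) g x) = f x]].
Proof.
move=> divF infF I0 I'0 _ /adjacent_neighbours nLL'; split.
- exact: KM1_minimal.
- by split; [apply: KM1_irreducible|apply: irreducible_is_KM1].
tfae.
- exact: M1_of_finite.
- exact: KM1_of_M1.
- by move=> <-; apply: KM1_irreducible.
- by move=> /(zero_sum_irreducible_KM1 divF infF I0 I'0 nLL')/quotient_irreducible.
- exact: quotient_trivial.
- move=> [f [fbij fG]]; apply: (finite_of_KM1 (K := K) nLL').
  exact: (KM1_of_quotient_trivial (f := f)).
Qed.
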